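(* For every $(x_0,y_0,z_0)\in\mathbb{R}^3$, the surface $\{(x,y,z)\in E(1,1) : e^{z+z_0}(y-y_0)+x-x_0=0\}$ is stable.
   Context: $E(1,1)$ denotes $\mathbb{R}^3$ with coordinates $(x,y,z)$ and the left-invariant vector fields $X=\partial_z$, $Y=\frac{1}{\sqrt2}(-e^{z}\partial_x+e^{-z}\partial_y)$, $T=\frac{1}{\sqrt2}(e^{z}\partial_x+e^{-z}\partial_y)$, with the Riemannian metric $\langle\cdot,\cdot\rangle$ making $\{X,Y,T\}$ orthonormal. The horizontal distribution is $\mathcal{H}=\mathrm{span}\{X,Y\}$. For a surface $\Sigma$ with Riemannian unit normal $N$, $N_h$ is the orthogonal projection of $N$ onto $\mathcal{H}$. The sub-Riemannian area is $A(\Sigma)=\int_\Sigma|N_h|\,d\Sigma$, with $d\Sigma$ the Riemannian area element. An area-stationary surface (critical point of $A$ under compactly supported deformations) is stable if the second derivative of the area at $0$ is nonnegative for every compactly supported variation. *)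

(* Defs.v *)
From HB Require Import structures.
From mathcomp Require Import all_boot all_order all_algebra.
From mathcomp Require Import all_classical all_reals all_analysis.
From mathcomp Require Import ring.
Set Implicit Arguments.
Unset Strict Implicit.
Unset Printing Implicit Defensive.
Import Order.TTheory GRing.Theory Num.Theory.
Import numFieldNormedType.Exports.
Local Open Scope classical_set_scope.
Local Open Scope ring_scope.

(** * Smooth maps *)

(* Iterated directional derivatives: [iter_derive [:: v1; ..; vn] f] is
   D_{v1} (... (D_{vn} f)). *)
Definition iter_derive {R : realType} {V W : normedModType R}
    (vs : seq V) (f : V -> W) : V -> W :=
  foldr (fun v g x => 'D_v g x) f vs.

(* Meant for D open and V finite-dimensional: all directional derivatives of
   all orders exist and are continuous on D, i.e. f is C^oo on D. *)
Definition smooth_on {R : realType} {V W : normedModType R}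
    (D : set V) (f : V -> W) : Prop :=
  forall (vs : seq V) (x : V), D x ->
    {for x, continuous (iter_derive vs f)} /\
    (forall v : V, derivable (iter_derive vs f) x v).

(** * The Riemannian manifold E(1,1) *)

(* R^3; the coordinates of p are x = p.1.1, y = p.1.2 and z = p.2. Tangent
   vectors are given by their components on the coordinate fields. *)
Notation R3 R := (R * R * R)%type.

Section Geometry.
Context {R : realType}.
Implicit Types p v w : R3 R.

Definition Xfield p : R3 R := (0, 0, 1).
Definition Yfield p : R3 R :=
  (- expR p.2 / Num.sqrt 2, expR (- p.2) / Num.sqrt 2, 0).
Definition Tfield p : R3 R :=
  (expR p.2 / Num.sqrt 2, expR (- p.2) / Num.sqrt 2, 0).

(* e^(-2z) dx^2 + e^(2z) dy^2 + dz^2, the metric for which X, Y, T is an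
   orthonormal frame (see [frame_orthonormal]). *)
Definition metric p v w : R :=
  expR (- p.2) ^+ 2 * (v.1.1 * w.1.1) + expR p.2 ^+ 2 * (v.1.2 * w.1.2)
  + v.2 * w.2.

Definition mnorm p v : R := Num.sqrt (metric p v v).

Lemma frame_orthonormal p :
  [/\ metric p (Xfield p) (Xfield p) = 1,
      metric p (Yfield p) (Yfield p) = 1 &
      metric p (Tfield p) (Tfield p) = 1] /\
  [/\ metric p (Xfield p) (Yfield p) = 0,
      metric p (Xfield p) (Tfield p) = 0 &
      metric p (Yfield p) (Tfield p) = 0].
Proof.
have e0 : expR p.2 != 0 :> R by rewrite gt_eqF // expR_gt0.
have s0 : Num.sqrt 2 != 0 :> R by rewrite gt_eqF // sqrtr_gt0 ltr0n.
have s2 : Num.sqrt 2 ^+ 2 = 2 :> R by rewrite sqr_sqrtr // ler0n.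
have h : 2 / Num.sqrt 2 ^+ 2 = 1 :> R by rewrite s2 divff // pnatr_eq0.
rewrite /metric /= expRN; split; split.
- by ring.
- by rewrite -[RHS]h; field; rewrite e0 s0.
- by rewrite -[RHS]h; field; rewrite e0 s0.
- by ring.
- by ring.
- by field; rewrite e0 s0.
Qed.

(* Orthogonal projection onto H = span {X, Y}. *)
Definition hproj p v : R3 R :=
  metric p v (Xfield p) *: Xfield p + metric p v (Yfield p) *: Yfield p.

(* Cross product for the metric on the tangent space at p: since
   det (metric p) = 1, it is the metric dual of w' |-> det (v, w, w'). *)
Definition cross p v w : R3 R :=
  (expR p.2 ^+ 2 * (v.1.2 * w.2 - v.2 * w.1.2),
   expR (- p.2) ^+ 2 * (v.2 * w.1.1 - v.1.1 * w.2),
   v.1.1 * w.1.2 - v.1.2 * w.1.1).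

Definition gram p v w : R :=
  metric p v v * metric p w w - metric p v w ^+ 2.

Lemma cross_orthogonal p v w :
  metric p (cross p v w) v = 0 /\ metric p (cross p v w) w = 0.
Proof.
have e0 : expR p.2 != 0 :> R by rewrite gt_eqF // expR_gt0.
by rewrite /metric /= expRN; split; field.
Qed.

Lemma metric_cross p v w :
  metric p (cross p v w) (cross p v w) = gram p v w.
Proof.
have e0 : expR p.2 != 0 :> R by rewrite gt_eqF // expR_gt0.
by rewrite /gram /metric /= expRN; field.
Qed.

(** * Parametrized surfaces and their area *)

Implicit Types (F : R * R -> R3 R) (q : R * R).

Definition du F q : R3 R := 'D_((1, 0) : R * R) F q.
Definition dv F q : R3 R := 'D_((0, 1) : R * R) F q.

Definition immersion_at F q : Prop :=
  forall a b : R, a *: du F q + b *: dv F q = 0 -> a = 0 /\ b = 0.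

Definition unit_normal F q : R3 R :=
  let n := cross (F q) (du F q) (dv F q) in (mnorm (F q) n)^-1 *: n.

Definition area_element F q : R := Num.sqrt (gram (F q) (du F q) (dv F q)).

(* Sub-Riemannian area of the part of the surface parametrized by K:
   integral over K of |N_h| dSigma. *)
Definition subarea F (K : set (R * R)) : R :=
  Rintegral (lebesgue_measure \x lebesgue_measure)%E K
    (fun q => mnorm (F q) (hproj (F q) (unit_normal F q)) * area_element F q).

(* F is a global chart of the embedded surface S: a smooth injective immersion
   with image S which is a homeomorphism onto S. *)
Definition global_chart F (S : set (R3 R)) : Prop :=
  [/\ smooth_on setT F,
      forall q, immersion_at F q,
      range F = S &
      exists G : R3 R -> R * R, cancel F G /\ {within S, continuous G}].

(** * Variations, stationarity and stability *)

(* (Psi s)_{|s| < eps} is a smooth deformation of F through immersed surfaces,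
   leaving the surface fixed outside the compact set K. *)
Definition variation F (eps : R) (K : set (R * R))
    (Psi : R -> R * R -> R3 R) : Prop :=
  [/\ 0 < eps /\ compact K,
      smooth_on [set sq : R * (R * R) | `|sq.1| < eps]
        (fun sq => Psi sq.1 sq.2),
      forall s q, `|s| < eps -> immersion_at (Psi s) q,
      forall q, Psi 0 q = F q &
      forall s q, `|s| < eps -> ~ K q -> Psi s q = F q].

(* The area of the deformed surfaces; the part outside K, possibly of infinite
   area, does not depend on s and is left out. *)
Definition varied_area (K : set (R * R)) (Psi : R -> R * R -> R3 R) (s : R)
  : R := subarea (Psi s) K.

Definition area_stationary F : Prop :=
  forall eps K Psi, variation F eps K Psi ->
    is_derive (0 : R) 1 (varied_area K Psi) 0.

(* The existence of the second derivative at 0 is part of the requirement; it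
   is not automatic in presence of singular points (N_h = 0). *)
Definition area_stable F : Prop :=
  area_stationary F /\
  forall eps K Psi, variation F eps K Psi ->
    let A := varied_area K Psi in
    [/\ \forall s \near (0 : R), derivable A s 1,
        derivable (derive1 A) 0 1 &
        0 <= derive1n 2 A 0].

(* The area does not depend on the chart, so any global chart will do. *)
Definition stable_surface (S : set (R3 R)) : Prop :=
  exists2 F : R * R -> R3 R, global_chart F S & area_stable F.

End Geometry.

(* Main.v *)
Require Import Defs.
From HB Require Import structures.
From mathcomp Require Import all_boot all_order all_algebra.
From mathcomp Require Import all_classical all_reals all_analysis.
From mathcomp Require Import measurable_realfun.
From mathcomp Require Import ring lra.
Set Implicit Arguments.
Unset Strict Implicit.
Unset Printing Implicit Defensive.
Import Order.TTheory GRing.Theory Num.Theory.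
Import numFieldNormedType.Exports.
Local Open Scope classical_set_scope.
Local Open Scope ring_scope.

(** The surface is calibrated. It belongs to the foliation of the space by its
    translates in the direction of x, which are isometric to it, and the
    horizontal unit normal of this foliation is a vector field that depends on
    y and z only, is free of divergence, and is singular along a line. Hence the
    flux of this field through a compactly supported deformation of the surface
    is constant, is at most the area of the deformed surface, and equals the area
    of the surface itself: the surface minimizes the area among its deformations.

    To stay within smooth forms, the horizontal field [calX] X + [calY] Y normal
    to the foliation is divided by [calnorm] = ([calX]^2 + [calY]^2 + e^2)^(1/2)
    for a small e > 0, instead of by its length. The dual 2-form remains closed,
    with the explicit primitives [calprim] and [calnorm]; it is still dominated
    by the area ([calform_le]), and on the surface it falls short of the area by
    a multiple of e only ([calform_ge]).
    Stokes' formula ([integral_jac_eq]) and the limit e -> 0 give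
    [varied_area_min]: the area A(s) of a variation has a minimum at s = 0.

    It remains to see that A is twice differentiable at 0, which is not automatic
    since the horizontal normal g(s, q) of the deformed surface vanishes
    somewhere: at s = 0 it has one zero, nondegenerate. The area is the integral
    of |g|, and [integrated_length_twice_derivable] differentiates it under the
    integral sign by dominated convergence ([is_derive_Rintegral]). For s near 0
    the zeros of g(s, .) form a null set ([ae_hyp_neq0]), and off it |g| has the
    derivative <g/|g|, dg/ds>, with bounded difference quotients. The difference
    quotients at s = 0 of this derivative are of the order of 1/|g(0, q)|, as
    normalization is Lipschitz with that constant ([unit_lipschitz]), and the
    inverse of the distance to a point is integrable in the plane
    ([integrable_inv_hyp]). So A'(0) exists and vanishes at the minimum, and
    A''(0) exists and is nonnegative ([derivatives_at_min]). *)

(** * Functions of class C^n *)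

(** All iterated directional derivatives up to order n exist and are continuous
    on D. Cutting smoothness off at a finite order makes its closure properties
    provable by induction on n, and tells how many derivatives are used. *)
Fixpoint Ck {R : realType} {V W : normedModType R} (n : nat) (D : set V)
    (f : V -> W) : Prop :=
  (forall x, D x -> {for x, continuous f}) /\
  if n is m.+1 then
    forall v, (forall x, D x -> derivable f x v) /\ Ck m D ('D_v f)
  else True.

Section Ck_theory.
Context {R : realType} {V : normedModType R}.
Implicit Types (W : normedModType R) (D : set V).

Lemma Ck_continuous W n D (f : V -> W) :
  Ck n D f -> forall x, D x -> {for x, continuous f}.
Proof. by case: n => [|n] []. Qed.

Lemma Ck_derivable W n D (f : V -> W) :
  Ck n.+1 D f -> forall x v, D x -> derivable f x v.
Proof. by move=> [_ h] x v Dx; have [+ _] := h v; apply. Qed.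

Lemma Ck_derive W n D (f : V -> W) v : Ck n.+1 D f -> Ck n D ('D_v f).
Proof. by move=> [_ h]; have [_] := h v. Qed.

Lemma CkS W n D (f : V -> W) : Ck n.+1 D f -> Ck n D f.
Proof.
elim: n f => [f [cf _]|n ih f]; first by split.
move=> [cf h]; split => // v; split; first by have [] := h v.
by apply: ih; have [] := h v.
Qed.

Lemma smooth_on_derive W D (f : V -> W) v :
  smooth_on D f -> smooth_on D ('D_v f).
Proof.
by move=> sf vs x Dx; have := sf (rcons vs v) x Dx; rewrite /iter_derive foldr_rcons.
Qed.

Lemma smooth_on_Ck W n D (f : V -> W) : smooth_on D f -> Ck n D f.
Proof.
elim: n f => [|n ih] f sf; (split; first by move=> x /(sf [::])[]) => //.
move=> v; split; first by move=> x /(sf [::])[_]; apply.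
exact/ih/smooth_on_derive.
Qed.

Lemma Ck_smooth_on W D (f : V -> W) : (forall n, Ck n D f) -> smooth_on D f.
Proof.
move=> + vs; elim/last_ind: vs f => [|vs v ih] f cf x Dx.
  by have [cf0 df] := cf 1; split; [exact: cf0|move=> v; have [+ _] := df v; exact].
rewrite /iter_derive foldr_rcons; apply: ih => // n.
exact/Ck_derive/cf.
Qed.

Lemma eq_Ck W n D (f g : V -> W) : open D -> (forall x, D x -> f x = g x) ->
  Ck n D f -> Ck n D g.
Proof.
move=> oD; have nD x h : D x -> (forall x, D x -> h x) -> \forall y \near x, h y.
  by move=> Dx fg; apply: filterS (open_nbhs_nbhs (conj oD Dx)).
elim: n f g => [|n ih] f g fg [cf df]; (split; first (move=> x Dx;
    rewrite /prop_for /continuous_at -(fg _ Dx);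
    apply: cvg_trans (cf _ Dx); apply: near_eq_cvg;
    exact: (nD x (fun y => f y = g y)))) => //.
move=> v; have [df1 df2] := df v; split.
  by move=> x Dx; apply: near_eq_derivable (df1 x Dx); exact: (nD x (fun y => f y = g y)).
apply: ih df2 => x Dx; apply: near_eq_derive.
exact: (nD x (fun y => f y = g y)).
Qed.

Lemma Ck_cst W n D (a : W) : open D -> Ck n D (fun=> a).
Proof.
move=> oD; elim: n a => [|n ih] a; (split; first by move=> x _; exact: cvg_cst) => //.
move=> v; split; first by move=> x _; exact: derivable_cst.
by apply: (eq_Ck oD _ (ih 0)) => x _; rewrite derive_cst.
Qed.

Lemma CkD W n D (f g : V -> W) : open D -> Ck n D f -> Ck n D g ->
  Ck n D (fun x => f x + g x).
Proof.
move=> oD; elim: n f g => [|n ih] f g [cf df] [cg dg];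
  (split; first by move=> x Dx; apply: cvgD; [exact: cf|exact: cg]) => //.
move=> v; have [df1 df2] := df v; have [dg1 dg2] := dg v.
split; first by move=> x Dx; apply: derivableD; [exact: df1|exact: dg1].
apply: (eq_Ck oD _ (ih _ _ df2 dg2)) => x Dx.
by rewrite [RHS]deriveD; [|exact: df1|exact: dg1].
Qed.

Lemma CkM n D (f g : V -> R) : open D -> Ck n D f -> Ck n D g ->
  Ck n D (fun x => f x * g x).
Proof.
move=> oD; elim: n f g => [|n ih] f g Cf Cg; have [cf df] := Cf; have [cg dg] := Cg;
  (split; first by move=> x Dx; apply: cvgM; [exact: cf|exact: cg]) => //.
move=> v; have [df1 df2] := df v; have [dg1 dg2] := dg v.
split; first by move=> x Dx; apply: derivableM; [exact: df1|exact: dg1].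
apply: (eq_Ck oD _ (CkD oD (ih _ _ (CkS Cf) dg2) (ih _ _ (CkS Cg) df2))) => x Dx.
by rewrite [RHS]deriveM; [|exact: df1|exact: dg1].
Qed.

Lemma CkN n D (f : V -> R) : open D -> Ck n D f -> Ck n D (fun x => - f x).
Proof.
move=> oD Cf; apply: (eq_Ck oD _ (CkM oD (Ck_cst n (-1 : R) oD) Cf)) => x _.
by rewrite mulN1r.
Qed.

Lemma CkB n D (f g : V -> R) : open D -> Ck n D f -> Ck n D g ->
  Ck n D (fun x => f x - g x).
Proof. by move=> oD Cf Cg; apply: CkD => //; exact: CkN. Qed.

(** This transports one-variable calculus (the chain rule, the mean value
    theorem) to directional derivatives. *)
Lemma is_derive_line W (f : V -> W) x v (df : W) :
  is_derive x v f df <-> is_derive (0 : R) 1 (fun h => f (h *: v + x)) df.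
Proof.
have e : 'D_v f x = 'D_1 (fun h : R => f (h *: v + x)) 0.
  rewrite /derive; set g1 := fun h => h^-1 *: _; set g2 := fun h => h^-1 *: _.
  suff -> : g1 = g2 by [].
  by rewrite funeqE /g1 /g2 => h /=; rewrite addr0 scale0r add0r [_%:A]mulr1.
split=> -[d1 d2]; apply: DeriveDef.
- by case: (derivable1P f x v) => + _; apply.
- by rewrite -e.
- by case: (derivable1P f x v) => _; apply.
- by rewrite e.
Qed.

Lemma is_derive_chain (phi : R -> R) (f : V -> R) x v (df dphi : R) :
  is_derive x v f df -> is_derive (f x) 1 phi dphi ->
  is_derive x v (fun y => phi (f y)) (dphi * df).
Proof.
move=> /is_derive_line hf hphi; apply/is_derive_line.
by apply: is_derive1_comp; rewrite scale0r add0r.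
Qed.

Lemma is_derive_add (f g : V -> R) x v (df dg : R) :
  is_derive x v f df -> is_derive x v g dg ->
  is_derive x v (fun y => f y + g y) (df + dg).
Proof. by move=> hf hg; exact: (is_deriveD hf hg). Qed.

Lemma is_derive_sub (f g : V -> R) x v (df dg : R) :
  is_derive x v f df -> is_derive x v g dg ->
  is_derive x v (fun y => f y - g y) (df - dg).
Proof. by move=> hf hg; exact: (is_deriveB hf hg). Qed.

Lemma is_derive_mul (f g : V -> R) x v (df dg : R) :
  is_derive x v f df -> is_derive x v g dg ->
  is_derive x v (fun y => f y * g y) (f x * dg + g x * df).
Proof. by move=> hf hg; exact: (is_deriveM hf hg). Qed.

Lemma Ck_exp n D (f : V -> R) : open D -> Ck n D f ->
  Ck n D (fun x => expR (f x)).
Proof.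
move=> oD; elim: n f => [|n ih] f Cf; have [cf df] := Cf;
  (split; first by move=> x Dx; apply: (@continuous_comp _ _ _ f expR); [exact: cf|exact: continuous_expR]) => //.
move=> v; have [df1 df2] := df v.
have h x : D x -> is_derive x v (fun y => expR (f y)) (expR (f x) * 'D_v f x).
  by move=> Dx; apply: is_derive_chain => //; apply: derivableP; exact: df1.
split; first by move=> x /h[].
by apply: (eq_Ck oD _ (CkM oD (ih _ (CkS Cf)) df2)) => x /h[_ ->].
Qed.

(** The condition on l is the part of linearity that difference quotients see;
    for a coordinate projection it holds by conversion. *)
Lemma is_derive_linear W1 W2 (l : W1 -> W2) (f : V -> W1) x v df :
  continuous l -> (forall k a b, l (k *: (a - b)) = k *: (l a - l b)) ->
  is_derive x v f df -> is_derive x v (fun y => l (f y)) (l df).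
Proof.
move=> cl ll [] fv <-.
have h : (fun h : R => h^-1 *: (((fun y => l (f y)) \o shift x) (h *: v) - l (f x)))
    @ 0^' --> l ('D_v f x).
  under eq_fun do rewrite /= -ll.
  exact: (continuous_cvg _ (cl _) fv).
by apply: DeriveDef; [exact: cvgP h|exact: cvg_lim h].
Qed.

Lemma Ck_linear W1 W2 n D (l : W1 -> W2) (f : V -> W1) :
  continuous l -> (forall k a b, l (k *: (a - b)) = k *: (l a - l b)) ->
  open D -> Ck n D f -> Ck n D (fun x => l (f x)).
Proof.
move=> cl ll oD; elim: n f => [|n ih] f [cf df];
  (split; first by move=> x Dx; apply: (@continuous_comp _ _ _ f l); [exact: cf|exact: cl]) => //.
move=> v; have [df1 df2] := df v.
have h x : D x -> is_derive x v (fun y => l (f y)) (l ('D_v f x)).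
  by move=> Dx; apply: is_derive_linear => //; apply: derivableP; exact: df1.
split; first by move=> x /h[].
by apply: (eq_Ck oD _ (ih _ df2)) => x /h[_ ->].
Qed.

Lemma is_derive_pair W1 W2 (f : V -> W1) (g : V -> W2) x v df dg :
  is_derive x v f df -> is_derive x v g dg ->
  is_derive x v (fun y => (f y, g y)) (df, dg).
Proof.
move=> [fv <-] [gv <-].
have h : (fun h : R => h^-1 *: (((fun y => (f y, g y)) \o shift x) (h *: v) - (f x, g x)))
    @ 0^' --> ('D_v f x, 'D_v g x).
  exact: (cvg_pair fv gv).
by apply: DeriveDef; [exact: cvgP h|exact: cvg_lim h].
Qed.

Lemma Ck_pair W1 W2 n D (f : V -> W1) (g : V -> W2) : open D ->
  Ck n D f -> Ck n D g -> Ck n D (fun x => (f x, g x)).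
Proof.
move=> oD; elim: n f g => [|n ih] f g [cf df] [cg dg];
  (split; first by move=> x Dx; apply: cvg_pair; [exact: cf|exact: cg]) => //.
move=> v; have [df1 df2] := df v; have [dg1 dg2] := dg v.
have h x : D x -> is_derive x v (fun y => (f y, g y)) ('D_v f x, 'D_v g x).
  by move=> Dx; apply: is_derive_pair; apply: derivableP; [exact: df1|exact: dg1].
split; first by move=> x /h[].
by apply: (eq_Ck oD _ (ih _ _ df2 dg2)) => x /h[_ ->].
Qed.

Lemma Ck_id n D : open D -> Ck n D (id : V -> V).
Proof.
case: n => [|n] oD; (split; first by move=> x _; exact: cvg_id) => //.
move=> v; split; first by move=> x _; exact: derivable_id.
by apply: (eq_Ck oD _ (Ck_cst _ v oD)) => x _; rewrite derive_id.
Qed.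

End Ck_theory.

Section slice.
Context {R : realType} {U V W : normedModType R}.

Lemma is_derive_slice (f : U * V -> W) s q v df :
  is_derive q v (fun y => f (s, y)) df <-> is_derive (s, q) (0, v) f df.
Proof.
rewrite is_derive_line [X in _ <-> X]is_derive_line.
suff -> : (fun h : R => f (h *: (0, v) + (s, q))) = (fun h => f (s, h *: v + q)) by [].
by apply/funext => h; congr f; congr pair => /=; rewrite scaler0 add0r.
Qed.

Lemma derive_slice (f : U * V -> W) s q v :
  'D_v (fun y => f (s, y)) q = 'D_(0, v) f (s, q).
Proof.
rewrite /derive; set g1 := fun h => h^-1 *: _; set g2 := fun h => h^-1 *: _.
suff -> : g1 = g2 by [].
apply/funext => h; rewrite /g1 /g2.
have e : h *: (0, v) + (s, q) = (s, h *: v + q) by congr pair => /=; rewrite scaler0 add0r.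
by rewrite /= e.
Qed.

Lemma Ck_slice n (D : set (U * V)) (f : U * V -> W) s : open D -> Ck n D f ->
  Ck n [set q | D (s, q)] (fun q => f (s, q)).
Proof.
have cs : continuous (fun q : V => (s, q)).
  by move=> q; apply: (@cvg_pair _ _ _ _ (nbhs s) (nbhs q)); [exact: cvg_cst|exact: cvg_id].
move=> oD; have oDs : open [set q | D (s, q)].
  by apply: (@open_comp _ _ (fun q : V => (s, q)) D) => // q _; exact: cs.
elim: n f => [|n ih] f [cf df]; (split; first (move=> x Dx;
    apply: (@continuous_comp _ _ _ (fun q : V => (s, q)) f);
    [exact: cs|exact: cf])) => //.
move=> v; have [df1 df2] := df (0, v).
split; first by move=> x /df1/derivableP/is_derive_slice[].
by apply: (eq_Ck oDs _ (ih _ df2)) => x Dx; rewrite derive_slice.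
Qed.

Lemma is_derive_slice1 (f : U * V -> W) s q v df :
  is_derive s v (fun y => f (y, q)) df <-> is_derive (s, q) (v, 0) f df.
Proof.
rewrite is_derive_line [X in _ <-> X]is_derive_line.
suff -> : (fun h : R => f (h *: (v, 0) + (s, q))) = (fun h => f (h *: v + s, q)) by [].
by apply/funext => h; congr f; congr pair => /=; rewrite scaler0 add0r.
Qed.

End slice.

(** * Area integrals of continuous functions in the plane *)

Notation mu2 R := (@lebesgue_measure R \x @lebesgue_measure R)%E.
Notation plane R := (measurableTypeR R * measurableTypeR R)%type.

Section plane_measure.
Context {R : realType}.
Implicit Types (A K : set (R * R)) (f : R * R -> R).

Lemma open_measurable2 A : open A -> measurable (A : set (plane R)).
Proof.
move=> oA.
pose box (a b c d : rat) : set (plane R) :=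
  `]ratr a, ratr b[%classic `*` `]ratr c, ratr d[%classic.
pose B a b c d := if `[< box a b c d `<=` A >] then box a b c d else set0.
have -> : A = \bigcup_a \bigcup_b \bigcup_c \bigcup_d B a b c d.
  apply/seteqP; split => [[x y] Axy|q [a _ [b _ [c _ [d _]]]]]; last first.
    by rewrite /B; case: asboolP => // + Bq; apply.
  have /nbhs_ballP[e /= e0 eA] := open_nbhs_nbhs (conj oA Axy).
  have between (z : R) : exists ab : rat * rat,
      [/\ z - e < ratr ab.1, ratr ab.1 < z, z < ratr ab.2 & ratr ab.2 < z + e].
    have /rat_in_itvoo[a] : z - e < z by rewrite ltrBlDr ltrDl.
    have /rat_in_itvoo[b] : z < z + e by rewrite ltrDl.
    by rewrite !in_itv /= => /andP[? ?] /andP[? ?]; exists (a, b).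
  have [[a b] /= [xa ax xb bx]] := between x.
  have [[c d] /= [yc cy yd dy]] := between y.
  exists a => //; exists b => //; exists c => //; exists d => //.
  rewrite /B; case: asboolP => [_|]; first by split; rewrite /= in_itv /= ?ax ?cy.
  case=> -[u v] [/=]; rewrite !in_itv /= => /andP[au ub] /andP[cv vd].
  by apply: eA; split; rewrite /ball /= ltr_norml; lra.
do 4 (apply: bigcupT_measurable_rat => ?).
by rewrite /B; case: asboolP => // _; apply: measurableX.
Qed.

Lemma compact_measurable2 K : compact K -> measurable (K : set (plane R)).
Proof.
move=> /compact_closed cK; rewrite -[K]setCK; apply: measurableC.
apply: open_measurable2; apply: closed_openC; apply: cK; exact: norm_hausdorff.
Qed.

Lemma continuous_measurable2 f : continuous f ->
  measurable_fun (setT : set (plane R)) (f : plane R -> R).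
Proof.
move=> /continuousP cf; apply: (measurability _ (RGenOpens.measurableE R)).
move=> _ [_ [a [b ->] <-]]; rewrite setTI; apply: open_measurable2.
exact/cf/interval_open.
Qed.

Definition square (M : R) : set (R * R) := `[- M, M]%classic `*` `[- M, M]%classic.

Lemma compact_square M : compact (square M).
Proof. by apply: compact_setX; exact: segment_compact. Qed.

Lemma measurable_square M : measurable (square M : set (plane R)).
Proof. by apply: compact_measurable2; exact: compact_square. Qed.

Lemma compact_sub_square K : compact K ->
  exists2 M, 0 < M & forall q, K q -> `|q.1| < M /\ `|q.2| < M.
Proof.
move=> /compact_bounded[N [_ hN]].
exists (`|N| + 1); first by rewrite ltr_pwDr.
move=> q Kq; have /= : `|q| <= `|N| + 2^-1.
  by apply: hN => //; rewrite (le_lt_trans (ler_norm N))// ltrDl invr_gt0.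
rewrite prod_normE ge_max => /andP[h1 h2].
have h : `|N| + 2^-1 < `|N| + 1 :> R by rewrite ltrD2l invf_lt1// ltr1n.
by split; [exact: le_lt_trans h1 h|exact: le_lt_trans h2 h].
Qed.

Lemma compact_measure2_fin K : compact K -> (mu2 R (K : set (plane R)) < +oo)%E.
Proof.
move=> cK; have [M M0 KM] := compact_sub_square cK.
apply: (@le_lt_trans _ _ (mu2 R (square M : set (plane R)))).
  apply: le_measure; rewrite ?inE.
  - exact: compact_measurable2.
  - exact: measurable_square.
  move=> q /KM[h1 h2]; split; rewrite /= in_itv /= -ler_norml; exact: ltW.
rewrite product_measure1E// lte_mul_pinfty//= lebesgue_measure_itv /=;
  by case: ifP => // _; rewrite ltry.
Qed.

Lemma continuous_integrable2 K f : compact K -> continuous f ->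
  (mu2 R).-integrable (K : set (plane R)) (EFin \o f).
Proof.
move=> cK cf; apply: measurable_bounded_integrable.
- exact: compact_measurable2.
- exact: compact_measure2_fin.
- by apply: measurable_funTS; exact: continuous_measurable2.
have /compact_bounded[M [Mr hM]] : compact (f @` K).
  by apply: continuous_compact => //; exact: continuous_subspaceT.
by exists M; split => // x Mx q Kq; apply: hM => //; exists q.
Qed.

End plane_measure.

(** * Vanishing of the integral of a derivative *)

Section divergence.
Context {R : realType}.
Implicit Types (f p : R * R -> R) (M : R).
Notation mu := (@lebesgue_measure R).

Lemma continuous_fst_slice f (v : R) : continuous f -> continuous (fun u : R => f (u, v)).
Proof.
move=> cf u; apply: (@continuous_comp _ _ _ (fun u : R => (u, v)) f); last exact: cf.
by apply: (@cvg_pair _ _ _ _ (nbhs u) (nbhs v)); [exact: cvg_id|exact: cvg_cst].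
Qed.

Lemma continuous_snd_slice f (u : R) : continuous f -> continuous (fun v : R => f (u, v)).
Proof.
move=> cf v; apply: (@continuous_comp _ _ _ (fun v : R => (u, v)) f); last exact: cf.
by apply: (@cvg_pair _ _ _ _ (nbhs u) (nbhs v)); [exact: cvg_cst|exact: cvg_id].
Qed.

Lemma integral_derive_eq0 (F f : R -> R) M : 0 < M -> continuous f ->
  (forall x : R, is_derive x 1 F (f x)) -> F (- M) = 0 -> F M = 0 ->
  (\int[mu]_(x in `[(- M)%R, M]) (f x)%:E = 0)%E.
Proof.
move=> M0 cf dF F1 F2.
have cF : continuous F.
  by move=> x; apply/differentiable_continuous/derivable1_diffP; have [] := dF x.
rewrite (@continuous_FTC2 _ f F).
- by rewrite F1 F2 subee.
- by rewrite gtrN.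
- exact: continuous_subspaceT.
- split; first by move=> x _; have [] := dF x.
  + exact: cvg_at_right_filter (cF _).
  + exact: cvg_at_left_filter (cF _).
- by move=> x _; rewrite derive1E; have [] := dF x.
Qed.

Lemma integral_square_fst_eq0 p M : continuous p ->
  (forall v, \int[mu]_(u in `[(- M)%R, M]) (p (u, v))%:E = 0)%E ->
  Rintegral (mu2 R) (square M) p = 0.
Proof.
move=> cp p0; rewrite /Rintegral integral_mkcond.
have ip : (mu2 R).-integrable (setT : set (plane R)) ((EFin \o p) \_ (square M)).
  apply/(integrable_mkcond _ (measurable_square M)).
  exact: continuous_integrable2 (@compact_square _ M) cp.
rewrite -(integral21_prod_meas1 ip) integral0_eq// => v _.
rewrite /fubini_G; have [vM|vM] := boolP (v \in `[- M, M]); last first.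
  rewrite integral0_eq// => u _; rewrite patchE ifF//.
  by apply/negbTE; rewrite notin_setE => -[_ /=]; apply/negP.
rewrite -[RHS](p0 v) [RHS]integral_mkcond; apply: eq_integral => u _.
rewrite !patchE; congr (if _ then _ else _); apply/idP/idP; rewrite !inE => //=.
by case.
Qed.

Lemma integral_square_snd_eq0 p M : continuous p ->
  (forall u, \int[mu]_(v in `[(- M)%R, M]) (p (u, v))%:E = 0)%E ->
  Rintegral (mu2 R) (square M) p = 0.
Proof.
move=> cp p0; rewrite /Rintegral integral_mkcond.
have ip : (mu2 R).-integrable (setT : set (plane R)) ((EFin \o p) \_ (square M)).
  apply/(integrable_mkcond _ (measurable_square M)).
  exact: continuous_integrable2 (@compact_square _ M) cp.
rewrite -(integral12_prod_meas1 ip) integral0_eq// => u _.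
rewrite /fubini_F; have [uM|uM] := boolP (u \in `[- M, M]); last first.
  rewrite integral0_eq// => v _; rewrite patchE ifF//.
  by apply/negbTE; rewrite notin_setE => -[/= + _]; apply/negP.
rewrite -[RHS](p0 u) [RHS]integral_mkcond; apply: eq_integral => v _.
rewrite !patchE; congr (if _ then _ else _); apply/idP/idP; rewrite !inE => //=.
by case.
Qed.

Lemma integral_derive_fst_eq0 f p M : 0 < M -> continuous p ->
  (forall q, is_derive q ((1, 0) : R * R) f (p q)) ->
  (forall v, f (- M, v) = 0 /\ f (M, v) = 0) ->
  Rintegral (mu2 R) (square M) p = 0.
Proof.
move=> M0 cp df f0; apply: integral_square_fst_eq0 => // v.
have [f1 f2] := f0 v.
apply: (integral_derive_eq0 M0 _ _ f1 f2); first exact: continuous_fst_slice.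
by move=> u; apply: (iffRL (is_derive_slice1 f u v 1 (p (u, v)))) ; exact: df.
Qed.

Lemma integral_derive_snd_eq0 f p M : 0 < M -> continuous p ->
  (forall q, is_derive q ((0, 1) : R * R) f (p q)) ->
  (forall u, f (u, - M) = 0 /\ f (u, M) = 0) ->
  Rintegral (mu2 R) (square M) p = 0.
Proof.
move=> M0 cp df f0; apply: integral_square_snd_eq0 => // u.
have [f1 f2] := f0 u.
apply: (integral_derive_eq0 M0 _ _ f1 f2); first exact: continuous_snd_slice.
by move=> v; apply: (iffRL (is_derive_slice f u v 1 (p (u, v)))); exact: df.
Qed.

End divergence.

(** * Symmetry of second derivatives and Stokes' formula *)

Section schwarz.
Context {R : realType} {V : normedModType R}.
Implicit Types (h : V -> R) (a b x : V).

Lemma is_derive_along h a x (s : R) : derivable h (s *: a + x) a ->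
  is_derive s 1 (fun s : R => h (s *: a + x)) ('D_a h (s *: a + x)).
Proof.
move=> /derivableP/is_derive_line hd; apply/is_derive_line.
apply: (@eq_ind _ _ (fun g => is_derive (0 : R) 1 g _) hd).
by apply/funext => k; rewrite addrA -scalerDl [k *: 1]mulr1.
Qed.

Lemma MVT_along (g dg : R -> R) (t : R) : 0 <= t ->
  (forall s : R, is_derive s 1 g (dg s)) ->
  exists2 s, 0 <= s <= t & g t - g 0 = t * dg s.
Proof.
move=> t0 dgE; have [|s st e] := @MVT_segment _ g dg 0 t t0 (fun (y : R) _ => dgE y).
  apply: continuous_subspaceT => s.
  by apply/differentiable_continuous/derivable1_diffP; have [] := dgE s.
by exists s; [move: st; rewrite in_itv|rewrite e subr0 mulrC].
Qed.

(** Two uses of the mean value theorem, first in the direction a and then in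
    the direction b. The second difference is symmetric in a and b, whence the
    symmetry of the mixed derivatives. *)
Lemma second_difference h a b x (t : R) : 0 <= t -> Ck 2 setT h ->
  exists s r, [/\ 0 <= s <= t, 0 <= r <= t &
    h (t *: a + (t *: b + x)) - h (t *: a + x) - (h (t *: b + x) - h x) =
    t * (t * 'D_b ('D_a h) (r *: b + (s *: a + x)))].
Proof.
move=> t0 Ch.
pose g s := h (s *: a + (t *: b + x)) - h (s *: a + x).
have [s st gE] : exists2 s, 0 <= s <= t & g t - g 0 = t *
    ('D_a h (s *: a + (t *: b + x)) - 'D_a h (s *: a + x)).
  apply: (@MVT_along g (fun s =>
    'D_a h (s *: a + (t *: b + x)) - 'D_a h (s *: a + x)) t t0) => s.
  by apply: is_derive_sub; apply: is_derive_along; exact: (Ck_derivable Ch).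
have [r rt kE] : exists2 r, 0 <= r <= t &
    'D_a h (t *: b + (s *: a + x)) - 'D_a h (0 *: b + (s *: a + x)) =
    t * 'D_b ('D_a h) (r *: b + (s *: a + x)).
  apply: (@MVT_along (fun r => 'D_a h (r *: b + (s *: a + x)))
    (fun r => 'D_b ('D_a h) (r *: b + (s *: a + x))) t t0) => r; apply: is_derive_along.
  exact: (Ck_derivable (Ck_derive a Ch)).
exists s, r; split => //; rewrite -kE scale0r add0r.
by rewrite (addrCA (t *: b)) -gE /g scale0r !add0r.
Qed.

Lemma derive_comm h a b x : Ck 2 setT h -> 'D_b ('D_a h) x = 'D_a ('D_b h) x.
Proof.
move=> Ch; apply/eqP; rewrite -subr_eq0; apply/negPn/negP => ne.
pose e := `|'D_b ('D_a h) x - 'D_a ('D_b h) x| / 2.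
have e0 : 0 < e by rewrite divr_gt0// normr_gt0.
have near_cont c d : \forall y \near x, `|'D_c ('D_d h) x - 'D_c ('D_d h) y| < e.
  have := Ck_continuous (Ck_derive c (Ck_derive d Ch)) (I : [set: V] x).
  by move=> /cvgrPdist_lt; apply.
have /nbhs_ballP[r /= r0 hr] : \forall y \near x,
    `|'D_b ('D_a h) x - 'D_b ('D_a h) y| < e /\
    `|'D_a ('D_b h) x - 'D_a ('D_b h) y| < e.
  by apply: filterI; exact: near_cont.
pose m := `|a| + `|b| + 1.
have m0 : 0 < m by rewrite ltr_wpDl// addr_ge0.
pose t := r / (2 * m).
have t0 : 0 < t by rewrite divr_gt0// mulr_gt0.
have close (c d : V) s k : `|c| + `|d| <= m -> 0 <= s <= t -> 0 <= k <= t ->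
    ball x r (k *: c + (s *: d + x)).
  move=> cd /andP[s0 st] /andP[k0 kt].
  rewrite -ball_normE /ball_ /= addrA opprD addrCA subrr addr0 normrN.
  apply: (@le_lt_trans _ _ (t * m)).
    apply: (le_trans (ler_normD _ _)); rewrite !normrZ !ger0_norm//.
    apply: (@le_trans _ _ (t * `|c| + t * `|d|)).
      by apply: lerD; exact: ler_wpM2r.
    by rewrite -mulrDr; apply: ler_wpM2l; [exact: ltW|].
  rewrite /t invfM mulrA mulfVK ?gt_eqF//.
  by rewrite ltr_pdivrMr// ltr_pMr// ltr1n.
have [s1 [k1 [hs1 hk1 e1]]] := second_difference a b x (ltW t0) Ch.
have [s2 [k2 [hs2 hk2 e2]]] := second_difference b a x (ltW t0) Ch.
have E : 'D_b ('D_a h) (k1 *: b + (s1 *: a + x)) =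
         'D_a ('D_b h) (k2 *: a + (s2 *: b + x)).
  have tn : t != 0 by rewrite gt_eqF.
  apply: (mulfI tn); apply: (mulfI tn); apply: (eq_trans (esym e1)).
  apply: (eq_trans _ e2); rewrite (addrCA (t *: b)).
  set A := h _; set B := h (t *: a + x); set C := h (t *: b + x); set D := h x.
  ring.
have abm : `|a| + `|b| <= m by rewrite lerDl.
have bam : `|b| + `|a| <= m by rewrite addrC.
have [B1 _] := hr _ (close b a s1 k1 bam hs1 hk1).
have [_ B2] := hr _ (close a b s2 k2 abm hs2 hk2).
have tri (X Y Z : R) : `|X - Z| < e -> `|Y - Z| < e -> `|X - Y| < e + e.
  by move=> XZ YZ; rewrite -(subrKA Z) (le_lt_trans (ler_normD _ _))// ltrD// distrC.
rewrite E in B1; have := tri _ _ _ B1 B2.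
by rewrite /e -splitr ltxx.
Qed.

End schwarz.

Section log.
Context {R : realType} {V : normedModType R}.
Implicit Types (D : set V) (f : V -> R).

Lemma Ck_ln n D f : open D -> (forall x, D x -> 0 < f x) -> Ck n D f ->
  Ck n D (fun x => ln (f x)).
Proof.
move=> oD f0; elim: n => [|n ih] Cf; have [cf df] := Cf;
  (split; first by move=> x Dx; apply: (@continuous_comp _ _ _ f (@ln R));
     [exact: cf|apply: continuous_ln; exact: f0]) => //.
move=> v; have [df1 df2] := df v.
have h x : D x -> is_derive x v (fun y => ln (f y)) (expR (- ln (f x)) * 'D_v f x).
  move=> Dx; rewrite expRN lnK ?posrE ?f0//.
  apply: is_derive_chain; first by apply: derivableP; exact: df1.
  by apply: is_derive1_ln; exact: f0.
split; first by move=> x /h[].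
(* The inverse of f is written as exp (- ln f), to which the induction
   hypothesis applies. *)
apply: (eq_Ck oD _ (CkM oD (Ck_exp oD (CkN oD (ih (CkS Cf)))) df2)).
by move=> x /h[_ ->].
Qed.

Lemma Ck_sqrt n D f : open D -> (forall x, D x -> 0 < f x) -> Ck n D f ->
  Ck n D (fun x => Num.sqrt (f x)).
Proof.
move=> oD f0 Cf.
apply: (eq_Ck oD _ (Ck_exp oD (CkM oD (Ck_cst n (2^-1 : R) oD) (Ck_ln oD f0 Cf)))).
move=> x /f0 fx0; apply/eqP; rewrite -(@eqrXn2 _ 2)// ?expR_ge0 ?sqrtr_ge0//.
rewrite sqr_sqrtr ?(ltW fx0)// -expRM_natl mulrA divff ?pnatr_eq0// mul1r.
by rewrite lnK.
Qed.

End log.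

(** The coefficient of the 2-form df /\ dh. *)
Definition jac {R : realType} (f h : R * R -> R) (q : R * R) : R :=
  'D_((1, 0) : R * R) f q * 'D_((0, 1) : R * R) h q
  - 'D_((0, 1) : R * R) f q * 'D_((1, 0) : R * R) h q.

Section stokes.
Context {R : realType}.
Implicit Types (f h : R * R -> R).

Lemma continuous_jac f h : Ck 1 setT f -> Ck 1 setT h -> continuous (jac f h).
Proof.
move=> Cf Ch q; have c (g : R * R -> R) v : Ck 1 setT g -> 'D_v g @ q --> 'D_v g q.
  by move=> Cg; exact: (Ck_continuous (Ck_derive v Cg)).
have := cvgB (cvgM (c f (1, 0) Cf) (c h (0, 1) Ch)) (cvgM (c f (0, 1) Cf) (c h (1, 0) Ch)).
by rewrite /jac; apply.
Qed.

(** Stokes' formula: df /\ dh is the exterior derivative of f dh, so that a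
    change of (f, h) away from the boundary does not alter its integral. Only h
    is differentiated twice. *)
Lemma integral_jac_eq (M : R) (K : set (R * R)) f0 f1 h0 h1 :
  0 < M -> closed K -> (forall q, K q -> `|q.1| < M /\ `|q.2| < M) ->
  Ck 1 setT f0 -> Ck 1 setT f1 -> Ck 2 setT h0 -> Ck 2 setT h1 ->
  (forall q, ~ K q -> f0 q = f1 q /\ h0 q = h1 q) ->
  Rintegral (mu2 R) (square M) (jac f1 h1) = Rintegral (mu2 R) (square M) (jac f0 h0).
Proof.
move=> M0 clK KM Cf0 Cf1 Ch0 Ch1 eqK.
pose e1 : R * R := (1, 0); pose e2 : R * R := (0, 1).
have cD (g : R * R -> R) v w q : Ck 2 setT g -> is_derive q w ('D_v g) ('D_w ('D_v g) q).
  by move=> Cg; apply: derivableP; exact: (Ck_derivable (Ck_derive v Cg)).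
pose P v q := f1 q * 'D_v h1 q - f0 q * 'D_v h0 q.
pose p v w q := f1 q * 'D_w ('D_v h1) q + 'D_v h1 q * 'D_w f1 q
  - (f0 q * 'D_w ('D_v h0) q + 'D_v h0 q * 'D_w f0 q).
have dP v w q : is_derive q w (P v) (p v w q).
  by apply: is_derive_sub; apply: is_derive_mul;
    [apply: derivableP; exact: (Ck_derivable Cf1)|exact: cD
    |apply: derivableP; exact: (Ck_derivable Cf0)|exact: cD].
have cp v w : continuous (p v w).
  have cf (g : R * R -> R) : Ck 1 setT g -> continuous g by move=> Cg q; exact: (Ck_continuous Cg).
  have cd (g : R * R -> R) u : Ck 1 setT g -> continuous ('D_u g).
    by move=> Cg q; exact: (Ck_continuous (Ck_derive u Cg)).
  move=> q; have c (f h : R * R -> R) : Ck 1 setT f -> Ck 2 setT h ->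
      (fun q => f q * 'D_w ('D_v h) q + 'D_v h q * 'D_w f q) @ q -->
      f q * 'D_w ('D_v h) q + 'D_v h q * 'D_w f q.
    move=> Cf Ch; exact: (cvgD (cvgM (cf _ Cf q) (cd _ w (Ck_derive v Ch) q))
      (cvgM (cd _ v (CkS Ch) q) (cd _ w Cf q))).
  exact: (cvgB (c _ _ Cf1 Ch1) (c _ _ Cf0 Ch0)).
have P0 v q : ~ K q -> P v q = 0.
  move=> Kq; have [eqf _] := eqK _ Kq.
  suff e : 'D_v h1 q = 'D_v h0 q by rewrite /P e eqf subrr.
  apply: near_eq_derive; apply: filterS (open_nbhs_nbhs (conj (closed_openC clK) Kq)).
  by move=> y /eqK[_ ->].
have nK1 v : ~ K (- M, v) /\ ~ K (M, v).
  by split => /KM[/= + _]; rewrite ?normrN ger0_norm ?ltxx// ltW.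
have nK2 u : ~ K (u, - M) /\ ~ K (u, M).
  by split => /KM[/= _]; rewrite ?normrN ger0_norm ?ltxx// ltW.
have i1 : Rintegral (mu2 R) (square M) (p e2 e1) = 0.
  apply: (integral_derive_fst_eq0 M0 (cp e2 e1) (dP e2 e1)) => v.
  by have [? ?] := nK1 v; split; exact: P0.
have i2 : Rintegral (mu2 R) (square M) (p e1 e2) = 0.
  apply: (integral_derive_snd_eq0 M0 (cp e1 e2) (dP e1 e2)) => u.
  by have [? ?] := nK2 u; split; exact: P0.
have mS : measurable (square M : set (plane R)) := measurable_square M.
have int g : continuous g -> (mu2 R).-integrable (square M : set (plane R)) (EFin \o g).
  exact: continuous_integrable2 (@compact_square _ M).
have cj0 := continuous_jac Cf0 (CkS Ch0); have cj1 := continuous_jac Cf1 (CkS Ch1).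
(* By symmetry of the second derivatives of h, the difference of the two forms
   is a divergence whose potentials P vanish on the boundary of the square. *)
apply/eqP; rewrite -subr_eq0 -RintegralB//; [|exact: int|exact: int].
have e : Rintegral (mu2 R) (square M) (fun q => jac f1 h1 q - jac f0 h0 q) =
    Rintegral (mu2 R) (square M) (fun q => p e2 e1 q - p e1 e2 q).
  apply: eq_Rintegral => q _.
  rewrite /jac /p -/e1 -/e2 (derive_comm e1 e2 q Ch0) (derive_comm e1 e2 q Ch1).
  move: ('D_e1 f1 q) ('D_e2 f1 q) ('D_e1 f0 q) ('D_e2 f0 q) ('D_e1 ('D_e2 h0) q)
    ('D_e1 ('D_e2 h1) q) ('D_e1 h1 q) ('D_e2 h1 q) ('D_e1 h0 q) ('D_e2 h0 q) (f0 q) (f1 q).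
  by move=> *; ring.
by rewrite e RintegralB//; [rewrite i1 i2 subrr|exact: int|exact: int].
Qed.

End stokes.

(** * Differentiation under the integral sign *)

Section diff_under_integral.
Context d {T : measurableType d} {R : realType} {mu : {measure set T -> \bar R}}.
Variables (K : set T) (f : R -> T -> R) (s0 : R) (df G : T -> R) (delta : R).
Hypotheses (mK : measurable K) (delta0 : 0 < delta).
Hypothesis intf : forall h, `|h| < delta -> mu.-integrable K (EFin \o f (h + s0)).
Hypothesis mdf : measurable_fun K df.
Hypothesis derf : {ae mu, forall q, K q -> is_derive s0 1 (f ^~ q) (df q)}.
Hypothesis intG : mu.-integrable K (EFin \o G).
Hypothesis lipf : {ae mu, forall q, K q ->
  forall h, `|h| < delta -> `|f (h + s0) q - f s0 q| <= G q * `|h|}.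

(** Almost everywhere differentiability suffices when the difference quotients
    have an integrable bound: this is dominated convergence along sequences. *)
Lemma is_derive_Rintegral :
  is_derive s0 1 (fun s => Rintegral mu K (f s)) (Rintegral mu K df).
Proof.
pose F s := Rintegral mu K (f s).
suff h : h^-1 *: (F (h + s0) - F s0) @[h --> 0^'] --> Rintegral mu K df.
  have e : (fun h : R => h^-1 *: ((F \o shift s0) (h *: 1) - F s0)) =
      (fun h => h^-1 *: (F (h + s0) - F s0)).
    by apply/funext => k; rewrite /= [k%:A]mulr1.
  apply: DeriveDef; first by rewrite /derivable e; exact: cvgP h.
  by rewrite /derive e; exact: cvg_lim h.
apply/cvgr_dnbhsP => t [t0 tcvg].
have [N _ tN] : \forall n \near \oo, `|t n| < delta.
  by move/cvgr0_norm_lt : tcvg; apply.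
rewrite -(cvg_shiftn N).
pose x n := t (n + N)%N.
have x0 n : x n != 0 by exact: t0.
have xd n : `|x n| < delta by apply: tN; rewrite /= leq_addl.
have xcvg : x n @[n --> \oo] --> 0 by rewrite (cvg_shiftn N).
pose g n q := (x n)^-1 * (f (x n + s0) q - f s0 q).
have if0 : mu.-integrable K (EFin \o f s0).
  by have := intf; move=> /(_ 0); rewrite normr0 add0r; apply.
have intB n : mu.-integrable K (EFin \o (fun q => f (x n + s0) q - f s0 q)).
  rewrite /comp; under eq_fun do rewrite EFinB.
  by apply: integrableB => //; exact: intf.
have intg n : mu.-integrable K (EFin \o g n).
  rewrite /g /comp; under eq_fun do rewrite EFinM.
  by apply: integrableZl => //; exact: intB.
have mg n : measurable_fun K (fun q => (g n q)%:E) by have /integrableP[] := intg n.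
have mdf' : measurable_fun K (fun q => (df q)%:E) by exact/measurable_EFinP.
have gdf : {ae mu, forall q, K q -> (g n q)%:E @[n --> \oo] --> (df q)%:E}.
  apply: filterS derf => q dq /dq[fq <-].
  apply/fine_cvgP; split; first exact: nearW.
  have fq' : h^-1 * (f (h + s0) q - f s0 q) @[h --> 0^'] --> 'D_1 (f ^~ q) s0.
    move: fq; rewrite /derivable /derive; under eq_fun do rewrite /= [_%:A]mulr1.
    exact.
  by move/cvgr_dnbhsP : fq' => /(_ x (conj x0 xcvg)).
have gG : {ae mu, forall q n, K q -> (`|(g n q)%:E| <= (EFin \o G) q)%E}.
  apply: filterS lipf => q lq n /lq/(_ _ (xd n)) h.
  by rewrite lee_fin /g normrM normfV mulrC ler_pdivrMr ?normr_gt0.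
have [idf _ cvgI] := dominated_convergence mK mg mdf' gdf intG gG.
rewrite (_ : (fun n => _) = (fun n => Rintegral mu K (g n))); last first.
  apply/funext => n; rewrite /F -(RintegralB mK (intf (xd n)) if0).
  by rewrite -[LHS](RintegralZl _ mK (intB n)).
by apply: fine_cvg; rewrite fineK//; exact: integrable_fin_num.
Qed.

End diff_under_integral.

(** * The length of a moving planar vector *)

Section planar_norm.
Context {R : realType}.
Implicit Types a b x y : R.

Definition hyp a b : R := Num.sqrt (a ^+ 2 + b ^+ 2).

Lemma hyp_ge0 a b : 0 <= hyp a b. Proof. exact: sqrtr_ge0. Qed.

Lemma sqr_hyp a b : hyp a b ^+ 2 = a ^+ 2 + b ^+ 2.
Proof. by rewrite sqr_sqrtr// addr_ge0// sqr_ge0. Qed.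

Lemma hypC a b : hyp a b = hyp b a.
Proof. by rewrite /hyp addrC. Qed.

Lemma ler_norm_hyp a b : `|a| <= hyp a b.
Proof. by rewrite -sqrtr_sqr ler_wsqrtr// lerDl sqr_ge0. Qed.

Lemma hyp_eq0 a b : hyp a b = 0 -> a = 0 /\ b = 0.
Proof.
move=> h0; split; apply/eqP; rewrite -normr_le0 -h0; first exact: ler_norm_hyp.
by rewrite hypC; exact: ler_norm_hyp.
Qed.

Lemma hyp_lipschitz a b x y : `|hyp x y - hyp a b| <= `|x - a| + `|y - b|.
Proof.
have := hyp_ge0 a b; rewrite le_eqVlt => /predU1P[/esym h0|h0].
  rewrite h0; have [-> ->] := hyp_eq0 h0; rewrite !subr0 ger0_norm ?hyp_ge0//.
  rewrite -(@ler_pXn2r _ 2) ?nnegrE ?hyp_ge0 ?addr_ge0// sqr_hyp sqrrD.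
  by rewrite !real_normK ?num_real// lerD2r lerDl mulrn_wge0// mulr_ge0.
have s0 : 0 < hyp x y + hyp a b by rewrite ltr_wpDl// hyp_ge0.
rewrite -(ler_pM2r s0) -{1}(ger0_norm (ltW s0)) -normrM -subr_sqr !sqr_hyp.
have -> : x ^+ 2 + y ^+ 2 - (a ^+ 2 + b ^+ 2) = (x - a) * (x + a) + (y - b) * (y + b) by ring.
apply: (le_trans (ler_normD _ _)); rewrite !normrM mulrDl.
apply: lerD; apply: ler_wpM2l => //; apply: (le_trans (ler_normD _ _)); apply: lerD;
  by [exact: ler_norm_hyp|rewrite hypC; exact: ler_norm_hyp].
Qed.

Lemma unit_le1 a b : `|a / hyp a b| <= 1.
Proof.
rewrite normrM normfV (ger0_norm (hyp_ge0 a b)).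
have := hyp_ge0 a b; rewrite le_eqVlt => /predU1P[<-|h0]; first by rewrite invr0 mulr0.
by rewrite ler_pdivrMr// mul1r ler_norm_hyp.
Qed.

(** Only the length of one of the two vectors enters the Lipschitz constant of
    the normalization: this is what makes the difference quotients of a unit
    normal integrable, the other length being out of control. *)
Lemma unit_lipschitz a b x y : hyp a b != 0 ->
  `|x / hyp x y - a / hyp a b| <= 2 * (`|x - a| + `|y - b|) / hyp a b.
Proof.
move=> n0; have p0 : 0 < hyp a b by rewrite lt_def n0 hyp_ge0.
have -> : x / hyp x y - a / hyp a b =
    ((x / hyp x y) * (hyp a b - hyp x y) + (x - a)) / hyp a b.
  have [h0|h0] := eqVneq (hyp x y) 0; last by field; rewrite n0 h0.
  by rewrite h0; have [-> _] := hyp_eq0 h0; rewrite !mul0r; field.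
rewrite normrM normfV (gtr0_norm p0); apply: ler_wpM2r; first by rewrite invr_ge0 ltW.
apply: (le_trans (ler_normD _ _)); rewrite normrM distrC.
apply: (@le_trans _ _ (1 * (`|x - a| + `|y - b|) + `|x - a|)).
  by rewrite lerD2r; apply: ler_pM => //; [exact: unit_le1|exact: hyp_lipschitz].
by rewrite mul1r mulrDl mul1r lerD2l lerDl.
Qed.

Lemma is_derive_hyp (f g : R -> R) (s df dg : R) :
  is_derive s 1 f df -> is_derive s 1 g dg -> hyp (f s) (g s) != 0 ->
  is_derive s 1 (fun s => hyp (f s) (g s)) ((f s * df + g s * dg) / hyp (f s) (g s)).
Proof.
move=> hf hg n0.
have p0 : 0 < f s ^+ 2 + g s ^+ 2.
  by rewrite -sqr_hyp exprn_gt0// lt_def n0 hyp_ge0.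
have h : is_derive s 1 (fun s => f s ^+ 2 + g s ^+ 2) (2 * (f s * df + g s * dg)).
  apply: (is_derive_eq (is_derive_add (is_derive_mul hf hf) (is_derive_mul hg hg))).
  by ring.
apply: (is_derive_eq (is_derive_chain h (is_derive1_sqrt p0))).
by rewrite -/(hyp _ _); field.
Qed.

Lemma cvg_hyp {T : topologicalType} (f g : T -> R) t :
  {for t, continuous f} -> {for t, continuous g} ->
  {for t, continuous (fun t => hyp (f t) (g t))}.
Proof.
move=> cf cg.
have h : (fun t => f t ^+ 2 + g t ^+ 2) @ t --> f t ^+ 2 + g t ^+ 2.
  exact: (cvgD (cvgM cf cf) (cvgM cg cg)).
rewrite /prop_for /continuous_at /hyp.
by apply: continuous_cvg h; exact: sqrt_continuous.
Qed.

Lemma measurable_inv_hyp (f g : R * R -> R) : continuous f -> continuous g ->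
  measurable_fun (setT : set (plane R)) (fun q => (hyp (f q) (g q))^-1).
Proof.
move=> cf cg.
(* Inversion is not continuous at 0, but the power -1 is measurable. *)
rewrite (_ : (fun q => _) = (fun q => hyp (f q) (g q) `^ (- 1))); last first.
  by apply/funext => q; rewrite powR_inv1// hyp_ge0.
apply: (measurableT_comp (measurable_powR (- 1))).
by apply: continuous_measurable2 => q; exact: (cvg_hyp (cf q) (cg q)).
Qed.

End planar_norm.

Section strip.
Context {R : realType}.
Notation V := (R * (R * R))%type.

Definition strip (eps : R) : set V := [set p | `|p.1| < eps].

Lemma open_strip eps : open (strip eps).
Proof.
rewrite (_ : strip eps = fst @^-1` [set x : R | `|x| < eps]) //.
apply: open_comp => [p _|]; first exact: cvg_fst.
by apply: (open_comp _ (@open_lt _ eps)) => x _; exact: norm_continuous.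
Qed.

Definition dparam (c : V -> R) : V -> R := 'D_((1, 0) : V) c.

Lemma is_derive_par n eps (c : V -> R) (s : R) q : Ck n.+1 (strip eps) c -> `|s| < eps ->
  is_derive s 1 (fun s => c (s, q)) (dparam c (s, q)).
Proof.
move=> Cc se; apply: (iffRL (is_derive_slice1 c s q 1 _)).
by apply: derivableP; exact: (Ck_derivable Cc).
Qed.

Lemma continuous_frozen n eps (c : V -> R) (s : R) : Ck n (strip eps) c -> `|s| < eps ->
  continuous (fun q => c (s, q)).
Proof.
by move=> Cc se q; exact: (Ck_continuous (Ck_slice s (@open_strip eps) Cc)).
Qed.

Variables (K : set (R * R)) (eps delta : R).
Hypotheses (cK : compact K) (de : delta < eps).

Lemma bounded_strip n (c : V -> R) : Ck n (strip eps) c ->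
  exists2 L, 0 <= L & forall s q, `|s| <= delta -> K q -> `|c (s, q)| <= L.
Proof.
move=> Cc; have /compact_bounded[M [_ hM]] : compact (c @` (`[- delta, delta]%classic `*` K)).
  apply: continuous_compact; last by apply: compact_setX => //; exact: segment_compact.
  apply: continuous_in_subspaceT => p /set_mem[/= h _].
  apply: (Ck_continuous Cc); rewrite /strip /=; move: h; rewrite in_itv /= -ler_norml.
  by move=> h; exact: le_lt_trans h de.
exists (`|M| + 1); first by rewrite addr_ge0.
move=> s q sd Kq; apply: (hM (`|M| + 1)); first by rewrite (le_lt_trans (ler_norm M))// ltrDl.
by exists (s, q) => //; split => //=; rewrite in_itv /= -ler_norml.
Qed.

Lemma lipschitz_strip n (c : V -> R) : Ck n.+1 (strip eps) c ->
  exists2 L, 0 <= L & forall s r q, `|s| <= delta -> `|r| <= delta -> K q ->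
    `|c (s, q) - c (r, q)| <= L * `|s - r|.
Proof.
move=> Cc; have [L L0 hL] := bounded_strip (Ck_derive ((1, 0) : V) Cc).
exists L => // s r q.
wlog rs : s r / r <= s.
  move=> wl sd rd Kq; have [?|/ltW ?] := leP r s; first exact: wl.
  by rewrite distrC (distrC s); exact: wl.
move=> /ler_normlP[_ sd] /ler_normlP[rd _] Kq.
have inside x : x \in `[r, s] -> `|x| <= delta.
  by rewrite in_itv /= ler_norml => /andP[rx xs]; rewrite (le_trans xs sd) lerNl (le_trans _ rd)// lerN2.
have dc x : x \in `[r, s] -> is_derive x 1 (fun s => c (s, q)) (dparam c (x, q)).
  by move=> /inside xd; apply: (is_derive_par _ Cc); exact: le_lt_trans xd de.
have h1 x : x \in `]r, s[ -> is_derive x 1 (fun s => c (s, q)) (dparam c (x, q)).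
  by move=> xrs; apply: dc; exact: subset_itv_oo_cc.
have h2 : {within `[r, s], continuous (fun s => c (s, q))}.
  by apply: derivable_within_continuous => x /dc[].
have [x xrs ->] := MVT_segment rs h1 h2.
rewrite normrM; apply: ler_wpM2r => //; apply: hL => //; exact: inside.
Qed.

End strip.

(** * Two derivatives of the integrated length *)

Section zero_set.
Context {R : realType}.
Notation V := (R * (R * R))%type.
Notation mu := (@lebesgue_measure R).

(** By Tonelli, since points are null on the vertical lines. *)
Lemma graph_null (Z : set (plane R)) : measurable Z ->
  (forall u v w, Z (u, v) -> Z (u, w) -> v = w) -> mu2 R Z = 0%E.
Proof.
move=> mZ Z1; rewrite /product_measure1 /=; apply: integral0_eq => u _.
have [Z0|/set0P[v Zv]] := eqVneq (xsection Z u) set0; first by rewrite Z0 measure0.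
rewrite (_ : xsection Z u = [set v]) ?lebesgue_measure_set1//.
apply/seteqP; split => [w|w /= ->] //.
move: Zv; rewrite /xsection /= !inE => Zv Zw; exact: Z1 Zw Zv.
Qed.

Variables (K : set (R * R)) (eps : R) (a b : V -> R) (q0 : R * R).
Hypotheses (cK : compact K) (eps0 : 0 < eps).
Hypotheses (Ca : Ck 0 (strip eps) a) (Cb : Ck 1 (strip eps) b).
Hypothesis zero0 : forall q, a (0, q) = 0 -> b (0, q) = 0 -> q = q0.
Hypothesis slope0 : 'D_((0, (0, 1)) : V) b (0, q0) != 0.

(** For all small parameters, b is strictly monotone along the vertical lines
    near q0, so that its zeros form a graph there; away from q0 there is no zero
    at all, by compactness of K. *)
Lemma ae_hyp_neq0 : exists2 delta, 0 < delta & forall s, `|s| < delta ->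
  {ae mu2 R, forall q : plane R, K q -> hyp (a (s, q)) (b (s, q)) != 0}.
Proof.
pose bv := 'D_((0, (0, 1)) : V) b.
have s00 : strip eps ((0, q0) : V) by rewrite /strip /= normr0.
have /nbhs_ballP[r /= r0 hr] : \forall p \near ((0, q0) : V), bv p != 0 /\ strip eps p.
  apply: filterI; last exact: (open_nbhs_nbhs (conj (@open_strip R eps) s00)).
  have cbv := Ck_continuous (Ck_derive ((0, (0, 1)) : V) Cb) s00.
  exact: (cvgr_neq0 (bv (0, q0)) cbv slope0).
have chyp q : {for ((0, q) : V), continuous (fun p => hyp (a p) (b p))}.
  have s0q : strip eps ((0, q) : V) by rewrite /strip /= normr0.
  exact: cvg_hyp (Ck_continuous Ca s0q) (Ck_continuous Cb s0q).
have : \forall s \near (0 : R), K `<=` (fun q => ball q0 r q \/ hyp (a (s, q)) (b (s, q)) != 0).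
  apply: ((iffLR (compact_near_coveringP K)) cK R (nbhs (0 : R))
    (fun s q => ball q0 r q \/ hyp (a (s, q)) (b (s, q)) != 0)) => q Kq.
  have [->|qq0] := eqVneq q q0.
    exists (ball q0 r, setT); first by split; [exact: nbhsx_ballx|exact: filterT].
    by move=> [q' s] [/= ? _]; left.
  have n0 : hyp (a (0, q)) (b (0, q)) != 0.
    by apply: contra qq0 => /eqP/hyp_eq0[a0 b0]; apply/eqP; exact: zero0.
  have [[A B] /= [nA nB] AB] := cvgr_neq0 (hyp (a (0, q)) (b (0, q))) (chyp q) n0.
  exists (B, A); first by split.
  move=> [q' s] [/= Bq' As]; right.
  exact: (AB (s, q')).
move=> /nbhs_ballP[r' /= r'0 hr'].
exists (Num.min r r'); first by rewrite lt_min r0.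
move=> s; rewrite lt_min => /andP[sr sr'].
have Br y : ball q0 r y -> ball ((0, q0) : V) r (s, y).
  by move=> qy; split => //; rewrite /ball /= sub0r normrN.
have ss : `|s| < eps by have [_] := hr _ (Br _ (ballxx q0 r0)).
pose Z : set (plane R) := [set q | ball q0 r q] `&` (fun q => b (s, q)) @^-1` [set 0].
have mZ : measurable Z.
  apply: measurableI; first by apply: open_measurable2; exact: ball_open.
  rewrite -[X in measurable X]setTI; apply: continuous_measurable2 => //.
  exact: continuous_frozen Cb ss.
exists Z; split => //.
  apply: graph_null => // u v w [/= b1 z1] [/= b2 z2].
  wlog vw : v w b1 z1 b2 z2 / v < w.
    move=> wl; have [vw|wv|//] := ltgtP v w; first exact: wl vw.
    by apply/esym; exact: wl wv.
  have inside x : v <= x <= w -> ball q0 r (u, x).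
    move: b1 b2 => [b11 b12] [_ b22] /andP[vx xw]; split => //.
    move: b12 b22; rewrite /ball /= !ltr_norml => /andP[? ?] /andP[? ?].
    by apply/andP; split; lra.
  have d x : v <= x <= w -> is_derive x 1 (fun y => b (s, (u, y))) (bv (s, (u, x))).
    move=> /inside/Br/hr[_ sx].
    apply: (iffRL (is_derive_slice (fun q => b (s, q)) u x 1 _)).
    apply: (iffRL (is_derive_slice b s (u, x) (0, 1) _)).
    by apply: derivableP; exact: (Ck_derivable Cb).
  have h1 x : x \in `]v, w[ -> is_derive x 1 (fun y => b (s, (u, y))) (bv (s, (u, x))).
    by move=> /subset_itv_oo_cc; rewrite in_itv /=; exact: d.
  have h2 : {within `[v, w], continuous (fun y => b (s, (u, y)))}.
    by apply: derivable_within_continuous => x; rewrite in_itv /= => /d[].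
  have [x xvw] := MVT_segment (ltW vw) h1 h2.
  rewrite z1 z2 subrr => /esym/eqP; rewrite mulf_eq0 subr_eq0 (gt_eqF vw) orbF.
  move: xvw; rewrite in_itv /= => /inside/Br/hr[/negbTE ->].
  by [].
move=> q /= /not_implyP[Kq /negP/negPn/eqP/hyp_eq0[aq bq]].
split => //; have := hr' s; rewrite /ball /= sub0r normrN => /(_ sr' q Kq)[//|].
by rewrite aq bq /hyp !expr0n addr0 sqrtr0 eqxx.
Qed.

End zero_set.

Section integrated_length.
Context {R : realType}.
Notation V := (R * (R * R))%type.
Variables (K : set (R * R)) (eps : R) (a b : V -> R) (q0 : R * R).
Hypotheses (cK : compact K) (eps0 : 0 < eps).
Hypotheses (Ca : Ck 2 (strip eps) a) (Cb : Ck 2 (strip eps) b).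
Hypothesis zero0 : forall q, a (0, q) = 0 -> b (0, q) = 0 -> q = q0.
Hypothesis slope0 : 'D_((0, (0, 1)) : V) b (0, q0) != 0.
Hypothesis int0 : (mu2 R).-integrable (K : set (plane R))
  (EFin \o (fun q => (hyp (a (0, q)) (b (0, q)))^-1)).

Let N (p : V) := hyp (a p) (b p).
Let U (p : V) := a p * dparam a p + b p * dparam b p.
Let E (p : V) := U p / N p.

Let mK : measurable (K : set (plane R)) := compact_measurable2 cK.

Let CU : Ck 1 (strip eps) U.
Proof.
have oS := @open_strip R eps.
exact: (CkD oS (CkM oS (CkS Ca) (Ck_derive _ Ca)) (CkM oS (CkS Cb) (Ck_derive _ Cb))).
Qed.

Let continuousN (s : R) : `|s| < eps -> continuous (fun q => N (s, q)).
Proof.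
move=> se q.
exact: cvg_hyp (continuous_frozen Ca se (x := q)) (continuous_frozen Cb se (x := q)).
Qed.

Let measurableVN (s : R) : `|s| < eps ->
  measurable_fun (K : set (plane R)) (fun q => (N (s, q))^-1).
Proof.
move=> se; apply: measurable_funTS.
exact: measurable_inv_hyp (continuous_frozen Ca se) (continuous_frozen Cb se).
Qed.

Let measurable_frozen n (c : V -> R) (s : R) : Ck n (strip eps) c -> `|s| < eps ->
  measurable_fun (K : set (plane R)) (fun q => c (s, q)).
Proof.
move=> Cc se; apply: measurable_funTS; apply: continuous_measurable2.
exact: continuous_frozen Cc se.
Qed.

Let measurableE (s : R) : `|s| < eps ->
  measurable_fun (K : set (plane R)) (fun q => E (s, q)).
Proof.
move=> se; apply: measurable_funM; last exact: measurableVN.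
exact: measurable_frozen CU se.
Qed.

Let derN (s : R) q : `|s| < eps -> N (s, q) != 0 ->
  is_derive s 1 (fun s => N (s, q)) (E (s, q)).
Proof.
by move=> se; exact: (is_derive_hyp (is_derive_par q Ca se) (is_derive_par q Cb se)).
Qed.

Let bounded_unit (L x : R) : 0 <= L -> `|x| <= L -> forall c d, `|c / hyp c d| * `|x| <= L.
Proof.
move=> L0 xL c d; rewrite -[leRHS]mul1r; apply: ler_pM => //; exact: unit_le1.
Qed.

Let half : eps / 2 < eps. Proof. by rewrite ltr_pdivrMr// ltr_pMr// ltr1n. Qed.

Lemma first_derivative : exists2 r, 0 < r & forall s : R, `|s| < r ->
  is_derive s 1 (fun s => Rintegral (mu2 R) K (fun q => N (s, q)))
    (Rintegral (mu2 R) K (fun q => E (s, q))).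
Proof.
have [La La0 lipa] := lipschitz_strip cK half (CkS Ca).
have [Lb Lb0 lipb] := lipschitz_strip cK half (CkS Cb).
have [r r0 aeN] := ae_hyp_neq0 cK eps0 (CkS (CkS Ca)) (CkS Cb) zero0 slope0.
exists (Num.min r (eps / 4)); first by rewrite lt_min r0 divr_gt0.
move=> s; rewrite lt_min => /andP[sr s4].
have small h : `|h| < eps / 4 -> `|h + s| <= eps / 2.
  by move=> h4; rewrite (le_trans (ler_normD _ _))//; lra.
have s2 : `|s| <= eps / 2.
  by have := small 0; rewrite normr0 add0r divr_gt0//; apply.
have lt_eps (h : R) : `|h| <= eps / 2 -> `|h| < eps by move=> h2; exact: le_lt_trans h2 half.
apply: (@is_derive_Rintegral _ _ R (mu2 R) K (fun s q => N (s, q)) s _ (fun=> La + Lb) (eps / 4)) => //.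
- by rewrite divr_gt0.
- move=> h /small/lt_eps hs; apply: continuous_integrable2 => //; exact: continuousN.
- by apply: measurableE; exact: lt_eps.
- apply: filterS (aeN s sr) => q n0 Kq; apply: derN; [exact: lt_eps|exact: n0].
- by apply: continuous_integrable2 => // q; exact: cvg_cst.
- apply: aeW => q Kq h /small hs; apply: (le_trans (hyp_lipschitz _ _ _ _)).
  rewrite mulrDl; apply: lerD.
    by apply: (le_trans (lipa _ _ _ hs s2 Kq)); rewrite addrK.
  by apply: (le_trans (lipb _ _ _ hs s2 Kq)); rewrite addrK.
Qed.

(** The first derivative is the integral of a scalar product with a unit vector.
    By [unit_lipschitz], its difference quotients are bounded by a multiple of the
    inverse of the initial length, which is integrable by [int0]. *)
Lemma second_derivative :
  exists l, is_derive (0 : R) 1 (fun s => Rintegral (mu2 R) K (fun q => E (s, q))) l.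
Proof.
have Ca' : Ck 1 (strip eps) (dparam a) := Ck_derive _ Ca.
have Cb' : Ck 1 (strip eps) (dparam b) := Ck_derive _ Cb.
have [La La0 lipa] := lipschitz_strip cK half (CkS Ca).
have [Lb Lb0 lipb] := lipschitz_strip cK half (CkS Cb).
have [La' La'0 lipa'] := lipschitz_strip cK half Ca'.
have [Lb' Lb'0 lipb'] := lipschitz_strip cK half Cb'.
have [Ma Ma0 bda] := bounded_strip cK half Ca'.
have [Mb Mb0 bdb] := bounded_strip cK half Cb'.
have [r r0 aeN] := ae_hyp_neq0 cK eps0 (CkS (CkS Ca)) (CkS Cb) zero0 slope0.
have lt_eps (h : R) : `|h| <= eps / 2 -> `|h| < eps by move=> h2; exact: le_lt_trans h2 half.
have e20 : 0 < eps / 2 by rewrite divr_gt0.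
have z2 : `|0 : R| <= eps / 2 by rewrite normr0 ltW.
have ze : `|0 : R| < eps by exact: lt_eps.
pose dE q := dparam U (0, q) * (N (0, q))^-1 - U (0, q) * ((N (0, q))^-1 * (N (0, q))^-1 * E (0, q)).
pose C := 2 * (La + Lb) * (Ma + Mb).
pose iN q := (N (0, q))^-1.
pose G q := C * iN q + (La' + Lb').
eexists.
apply: (@is_derive_Rintegral _ _ R (mu2 R) K (fun s q => E (s, q)) 0 dE G (eps / 2)) => //.
- move=> h /ltW h2; rewrite addr0; have hs := lt_eps _ h2.
  apply: measurable_bounded_integrable => //.
  + exact: compact_measure2_fin.
  + exact: measurableE.
  exists (Ma + Mb); split; first exact: num_real.
  move=> x Mx q Kq; apply: le_trans (ltW Mx).
  rewrite /E /U mulrDl -!(mulrAC _ _^-1) (le_trans (ler_normD _ _))// !normrM.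
  apply: lerD; rewrite -normrM; first by apply: bounded_unit => //; exact: bda.
  by rewrite /N hypC; apply: bounded_unit => //; exact: bdb.
- have mU' : measurable_fun (K : set (plane R)) (fun q => dparam U (0, q)).
    exact: measurable_frozen (Ck_derive _ CU) ze.
  have mU : measurable_fun (K : set (plane R)) (fun q => U (0, q)).
    exact: measurable_frozen CU ze.
  have mV := measurableVN ze; have mE := measurableE ze.
  exact: (measurable_funB (measurable_funM mU' mV)
    (measurable_funM mU (measurable_funM (measurable_funM mV mV) mE))).
- have := aeN 0; rewrite normr0 => /(_ r0); apply: filterS => q n0 Kq.
  have hN := derN ze (n0 Kq).
  have hU : is_derive (0 : R) 1 (fun s => U (s, q)) (dparam U (0, q)) := is_derive_par q CU ze.
  have hE := is_derive_mul hU (@is_deriveV _ (fun s => N (s, q)) 0 _ _ (n0 Kq) hN).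
  change (is_derive (0 : R) 1 (fun s => E (s, q)) (dE q)).
  have <- : U (0, q) * (- (N (0, q)) ^- 2 *: E (0, q)) + (N (0, q))^-1 * dparam U (0, q) = dE q.
    rewrite /dE [_ *: _]mulNr -exprVn expr2.
    by move: (U _) (dparam U _) (N _)^-1 (E _) => *; ring.
  exact: hE.
- rewrite /G; have -> : EFin \o (fun q => C * iN q + (La' + Lb')) =
     (fun q => C%:E * (EFin \o iN) q + (EFin \o (fun=> (La' + Lb')%R)) q)%E.
    by apply/funext => q; rewrite /= EFinD EFinM.
  apply: integrableD => //; first exact: integrableZl.
  by apply: continuous_integrable2 => // q; exact: cvg_cst.
have := aeN 0; rewrite normr0 => /(_ r0); apply: filterS => q n0 Kq h /ltW h2; rewrite addr0.
have {}n0 := n0 Kq; have p0 : 0 < N (0, q) by rewrite lt_def n0 hyp_ge0.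
have sub (c : V -> R) L : (forall s r q, `|s| <= eps / 2 -> `|r| <= eps / 2 -> K q ->
    `|c (s, q) - c (r, q)| <= L * `|s - r|) -> `|c (h, q) - c (0, q)| <= L * `|h|.
  by move=> lip; have := lip h 0 q h2 z2 Kq; rewrite subr0.
have ha := sub _ _ lipa; have hb := sub _ _ lipb.
have ha' := sub _ _ lipa'; have hb' := sub _ _ lipb'.
have ba := bda h q h2 Kq; have bb := bdb h q h2 Kq.
have ua := unit_lipschitz (a (h, q)) (b (h, q)) n0.
have ub : `|b (h, q) / N (h, q) - b (0, q) / N (0, q)| <=
    2 * (`|a (h, q) - a (0, q)| + `|b (h, q) - b (0, q)|) / N (0, q).
  rewrite /N (hypC (a (h, q))) (hypC (a (0, q))) (addrC `|a _ - _|).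
  by apply: unit_lipschitz; rewrite hypC.
have D0 : 2 * (`|a (h, q) - a (0, q)| + `|b (h, q) - b (0, q)|) / N (0, q) <=
    2 * (La + Lb) / N (0, q) * `|h|.
  rewrite [leRHS]mulrAC; apply: ler_wpM2r; first by rewrite invr_ge0 ltW.
  by rewrite -[leRHS]mulrA; apply: ler_wpM2l => //; rewrite mulrDl; exact: lerD.
have -> : E (h, q) - E (0, q) =
    (a (h, q) / N (h, q) - a (0, q) / N (0, q)) * dparam a (h, q)
    + (b (h, q) / N (h, q) - b (0, q) / N (0, q)) * dparam b (h, q)
    + (a (0, q) / N (0, q) * (dparam a (h, q) - dparam a (0, q))
    + b (0, q) / N (0, q) * (dparam b (h, q) - dparam b (0, q))).
  rewrite /E /U.
  move: (a (h, q)) (b (h, q)) (a (0, q)) (b (0, q)) (dparam a (h, q)) (dparam b (h, q))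
    (dparam a (0, q)) (dparam b (0, q)) (N (h, q))^-1 (N (0, q))^-1.
  by move=> *; ring.
have -> : G q * `|h| = 2 * (La + Lb) / N (0, q) * `|h| * Ma + 2 * (La + Lb) / N (0, q) * `|h| * Mb
    + (La' * `|h| + Lb' * `|h|).
  by rewrite /G /C /iN; ring.
apply: (le_trans (ler_normD _ _)); apply: lerD; apply: (le_trans (ler_normD _ _));
  apply: lerD; rewrite normrM.
- by apply: ler_pM => //; exact: le_trans ua D0.
- by apply: ler_pM => //; exact: le_trans ub D0.
- by rewrite -[leRHS]mul1r; apply: ler_pM => //; exact: unit_le1.
- by rewrite -[leRHS]mul1r; apply: ler_pM => //; rewrite /N hypC; exact: unit_le1.
Qed.

Lemma integrated_length_twice_derivable : exists r A1 l, [/\ 0 < r,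
  forall s : R, `|s| < r ->
    is_derive s 1 (fun s => Rintegral (mu2 R) K (fun q => hyp (a (s, q)) (b (s, q)))) (A1 s) &
  is_derive (0 : R) 1 A1 l].
Proof.
have [r r0 d1] := first_derivative; have [l d2] := second_derivative.
by exists r, (fun s => Rintegral (mu2 R) K (fun q => E (s, q))), l.
Qed.

End integrated_length.

(** The second order condition at a minimum, when the first derivative is only
    known to be differentiable at that point. *)
Lemma derivatives_at_min {R : realType} (A A1 : R -> R) (r l : R) : 0 < r ->
  (forall s : R, `|s| < r -> is_derive s 1 A (A1 s)) -> is_derive (0 : R) 1 A1 l ->
  (forall s, `|s| < r -> A 0 <= A s) -> A1 0 = 0 /\ 0 <= l.
Proof.
move=> r0 dA dA1 minA.
have in_r (t : R) : t \in `](- r), r[ -> `|t| < r by rewrite in_itv /= ltr_norml.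
have A10 : A1 0 = 0.
  have z : (0 : R) \in `](- r), r[ by rewrite in_itv /= oppr_lt0 r0.
  have [_ <-] := dA 0 (in_r 0 z).
  have rr : - r <= r by rewrite ge0_cp// ltW.
  have dA' t : t \in `](- r), r[ -> derivable A t 1 by move=> /in_r/dA[].
  have [_ ->] := derive1_at_min rr dA' z (fun t h => minA t (in_r t h)).
  by [].
split => //; rewrite leNgt; apply/negP => l0.
have [fd lE] := dA1.
have cv : (fun h : R => h^-1 *: (A1 (h *: 1 + 0) - A1 0)) @ 0^' --> l.
  by rewrite -lE; exact: fd.
have near0 : \forall h \near (0 : R), h != 0 -> h^-1 *: (A1 (h *: 1 + 0) - A1 0) < 0.
  exact: (cvgr_lt l cv _ l0).
have /nbhs_ballP[e /= e0 he] := near0.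
pose t := Num.min (e / 2) (r / 2).
have t0 : 0 < t by rewrite lt_min !divr_gt0.
have lt_half (z : R) : 0 < z -> z / 2 < z by move=> z0; rewrite ltr_pdivrMr// ltr_pMr// ltr1n.
have te : t < e by rewrite gt_min lt_half.
have tr : t < r by rewrite gt_min (lt_half r)// orbT.
have inside x : 0 <= x <= t -> `|x| < r.
  by move=> /andP[x0 xt]; rewrite ger0_norm//; exact: le_lt_trans xt tr.
have h1 x : x \in `]0, t[ -> is_derive x 1 A (A1 x).
  by move=> /subset_itv_oo_cc; rewrite in_itv /= => /inside/dA.
have h2 : {within `[0, t], continuous A}.
  by apply: derivable_within_continuous => x; rewrite in_itv /= => /inside/dA[].
have [x] := MVT t0 h1 h2; rewrite in_itv /= subr0 => /andP[x0 xt] e1.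
have : A1 x < 0.
  have := he x; rewrite /ball /= sub0r normrN gtr0_norm// => /(_ (lt_trans xt te)).
  move=> /(_ (lt0r_neq0 x0)); rewrite A10 subr0 addr0 [x *: 1]mulr1.
  by rewrite [_ *: _]mulrC pmulr_llt0// invr_gt0.
apply/negP; rewrite -leNgt -(pmulr_lge0 _ t0) -e1 subr_ge0.
by apply: minA; apply: inside; rewrite lexx ltW.
Qed.

(** * Integrability of the inverse distance in the plane *)

Section inverse_distance.
Context {R : realType}.
Notation mu := (@lebesgue_measure R).

Definition invsqrt (x : R) : R := (Num.sqrt `|x|)^-1.

Lemma invsqrt_ge0 x : 0 <= invsqrt x.
Proof. by rewrite invr_ge0 sqrtr_ge0. Qed.

Lemma measurable_invsqrt : measurable_fun setT invsqrt.
Proof.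
rewrite (_ : invsqrt = (fun x => Num.sqrt `|x| `^ (- 1))); last first.
  by apply/funext => x; rewrite powR_inv1 ?sqrtr_ge0.
apply: (measurableT_comp (measurable_powR (- 1))).
apply: continuous_measurable_fun => x.
apply: (@continuous_comp _ _ _ (fun y : R => `|y|) Num.sqrt); first exact: norm_continuous.
exact: sqrt_continuous.
Qed.

Lemma integral_invsqrt_pos (d M : R) : 0 < d -> d < M ->
  (\int[mu]_(x in `[d, M]) (invsqrt x)%:E <= (2 * Num.sqrt M)%:E)%E.
Proof.
move=> d0 dM.
have M0 : 0 < M := lt_trans d0 dM.
have dF (x : R) : 0 < x -> is_derive x 1 (fun x => 2 * Num.sqrt x) (invsqrt x).
  move=> x0.
  have h := is_derive_mul (is_derive_cst (2 : R) x (1 : R)) (is_derive1_sqrt x0).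
  apply: (is_derive_eq h).
  rewrite mulr0 addr0 /invsqrt gtr0_norm//; field.
  by rewrite gt_eqF// sqrtr_gt0.
have cF (x : R) : 0 < x -> {for x, continuous (fun x => 2 * Num.sqrt x)}.
  by move=> x0; apply/differentiable_continuous/derivable1_diffP; have [] := dF x x0.
have pos (x : R) : x \in `[d, M] -> 0 < x.
  by rewrite in_itv /= => /andP[dx _]; exact: lt_le_trans dx.
rewrite (@continuous_FTC2 _ invsqrt (fun x => 2 * Num.sqrt x))//.
- by rewrite -EFinB lee_fin gerBl mulr_ge0// sqrtr_ge0.
- apply: continuous_in_subspaceT => x /set_mem/= /pos x0.
  apply: cvgV; first by rewrite gt_eqF// sqrtr_gt0 normr_gt0 gt_eqF.
  apply: (@continuous_comp _ _ _ (fun y : R => `|y|) Num.sqrt); first exact: norm_continuous.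
  exact: sqrt_continuous.
- split.
  + by move=> x /subset_itv_oo_cc/pos/dF[].
  + by apply: cvg_at_right_filter; exact: cF.
  + by apply: cvg_at_left_filter; exact: cF.
- by move=> x /subset_itv_oo_cc/pos/dF[_]; rewrite derive1E.
Qed.

Lemma integral_invsqrt_oc (M : R) : 0 < M ->
  (\int[mu]_(x in `]0%R, M]) (invsqrt x)%:E <= (2 * Num.sqrt M)%:E)%E.
Proof.
move=> M0.
pose F n : set R := `[M / n.+2%:R, M]%classic.
have FE : `]0%R, M]%classic = \bigcup_n F n.
  apply/seteqP; split => [x|x [n _]]; rewrite /F /= !in_itv /= => /andP[x0 xM]; last first.
    by rewrite xM andbT (lt_le_trans _ x0)// divr_gt0.
  exists (Num.bound (M / x)) => //=; rewrite in_itv /= xM andbT.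
  rewrite ler_pdivrMr// mulrC -ler_pdivrMr// (le_trans (ltW (archi_boundP _)))//.
    by rewrite divr_ge0 ?ltW.
  by rewrite ler_nat -addn2 leq_addr.
have mi (D : set R) : measurable_fun D (fun x => (invsqrt x)%:E).
  by apply/measurable_EFinP; apply: measurable_funTS; exact: measurable_invsqrt.
have cvgF : (\int[mu]_(x in F n) (invsqrt x)%:E @[n --> \oo] -->
    \int[mu]_(x in `]0%R, M]) (invsqrt x)%:E)%E.
  rewrite FE; apply: ge0_nondecreasing_set_cvg_integral => //.
  - move=> n m nm; apply/subsetPset => x; rewrite /F /= !in_itv /= => /andP[h xM].
    rewrite xM andbT (le_trans _ h)//; apply: ler_wpM2l; first exact: ltW.
    by rewrite lef_pV2 ?posrE ?ltr0n// ler_nat !ltnS.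
  - by move=> n; exact: measurable_itv.
  - by move=> n; exact: mi.
  - by move=> n x _; rewrite lee_fin invsqrt_ge0.
apply: (cvge_to_le cvgF); apply: nearW => n.
apply: integral_invsqrt_pos; first by rewrite divr_gt0.
by rewrite ltr_pdivrMr// ltr_pMr// ltr1n.
Qed.

(** The negative half is reduced to the positive one by reflection. *)
Lemma integral_invsqrt_lty (M : R) : 0 < M ->
  (\int[mu]_(x in `[(- M)%R, M]) (invsqrt x)%:E < +oo)%E.
Proof.
move=> M0.
have mi (D : set R) : measurable_fun D (fun x => (invsqrt x)%:E).
  by apply/measurable_EFinP; apply: measurable_funTS; exact: measurable_invsqrt.
have i0 (x : R) : (0 <= (invsqrt x)%:E)%E by rewrite lee_fin invsqrt_ge0.
rewrite (@itv_bndbnd_setU _ _ _ (BRight 0)); last 2 first.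
  by rewrite bnd_simp oppr_le0 ltW.
  by rewrite bnd_simp ltW.
rewrite ge0_integral_setU//; [|exact: mi|]; last first.
  apply/disj_setPS => x [/=]; rewrite !in_itv /= => /andP[_ x0] /andP[].
  by rewrite ltNge x0.
have hp := le_lt_trans (integral_invsqrt_oc M0) (ltry _).
apply: lte_add_pinfty => //.
pose f (x : R) : \bar R := if x <= M then (invsqrt x)%:E else 0%E.
have fE (D E : set R) (g : R -> R) : (forall x, D x -> (g x <= M) = (x \in E)) ->
    (forall x, invsqrt (g x) = invsqrt x) ->
    (\int[mu]_(x in D) f (g x) = \int[mu]_(x in D `&` E) (invsqrt x)%:E)%E.
  move=> DE ge; rewrite integral_mkcondr; apply: eq_integral => x /set_mem Dx.
  by rewrite /f DE// ge patchE.
have mf : measurable_fun setT f.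
  by apply: measurable_fun_ifT => //; apply: measurable_fun_ler => //; exact: measurable_id.
have f0 x : (0 <= f x)%E by rewrite /f; case: ifP.
have sub := ge0_integration_by_substitution0 mf f0.
have eN := fE `]-oo, 0%R]%classic `[- M, +oo[%classic (fun x => - x).
rewrite (_ : `[- M, 0]%classic = `]-oo, 0%R]%classic `&` `[- M, +oo[%classic); last first.
  apply/seteqP; split => x; rewrite /= !in_itv /= ?andbT; first by move=> /andP[-> ->].
  by move=> [-> ->].
rewrite -eN; last 2 first.
  move=> x _; rewrite lerNl; apply/idP/idP; rewrite inE /= in_itv /= andbT //.
  by move=> x; rewrite /invsqrt normrN.
rewrite -sub (fE _ `]-oo, M]%classic id)//; last first.
  by move=> x _; apply/idP/idP; rewrite inE /= in_itv.
rewrite (_ : _ `&` _ = `[0%R, M]%classic); last first.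
  apply/seteqP; split => x; rewrite /= !in_itv /= ?andbT; first by move=> [-> ->].
  by move=> /andP[-> ->].
by rewrite -integral_itv_obnd_cbnd.
Qed.


Lemma integrable_invsqrt_square (M : R) : 0 < M ->
  (mu2 R).-integrable (square M : set (plane R))
    (EFin \o (fun q => invsqrt q.1 * invsqrt q.2)).
Proof.
move=> M0; pose k : R -> R := invsqrt \_ `[- M, M]%classic.
have mk : measurable_fun setT k.
  apply/(measurable_restrictT _ (measurable_itv _)).
  by apply: measurable_funTS; exact: measurable_invsqrt.
have k0 x : 0 <= k x by rewrite /k patchE; case: ifP => // _; exact: invsqrt_ge0.
have ik : (\int[mu]_x (k x)%:E < +oo)%E.
  rewrite (_ : (fun x => (k x)%:E) = (EFin \o invsqrt) \_ `[- M, M]%classic).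
    by rewrite -integral_mkcond; exact: integral_invsqrt_lty.
  by rewrite /k restrict_EFin.
have ik0 : (0 <= \int[mu]_x (k x)%:E)%E by apply: integral_ge0 => x _; rewrite lee_fin.
apply/(integrable_mkcond _ (measurable_square M)).
rewrite (_ : _ \_ _ = (fun q => (k q.1 * k q.2)%:E)); last first.
  apply/funext => -[x y]; rewrite patchE /k !patchE /square in_setX /=.
  by do 2 case: (_ \in _); rewrite /= ?mulr0 ?mul0r.
have mkk : measurable_fun (setT : set (plane R)) (fun q => (k q.1 * k q.2)%:E).
  apply/measurable_EFinP; apply: measurable_funM.
    exact: (measurableT_comp mk measurable_fst).
  exact: (measurableT_comp mk measurable_snd).
apply/(integrable12ltyP _ _ mkk).
have mkE : measurable_fun setT (EFin \o k) by exact/measurable_EFinP.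
have e (x : R) : (\int[mu]_y `|(k x * k y)%:E| = (k x)%:E * \int[mu]_y (k y)%:E)%E.
  rewrite -(@ge0_integralZl _ _ R mu setT measurableT (EFin \o k) mkE (k x)%:E).
  - by apply: eq_integral => y _; rewrite gee0_abs ?lee_fin ?mulr_ge0// EFinM.
  - by move=> y _; rewrite lee_fin.
  - by rewrite lee_fin.
under eq_integral => x _ do rewrite /= e.
rewrite (@ge0_integralZr _ _ R mu setT measurableT (EFin \o k) mkE).
- by rewrite lte_mul_pinfty// ge0_fin_numE.
- by move=> x _; rewrite lee_fin.
- exact: ik0.
Qed.

(** By the inequality of the means, the inverse of the distance to the origin is
    at most the product of the inverse square roots of the coordinates, each of
    which is locally integrable. *)
Lemma integrable_inv_hyp (K : set (R * R)) (a b : R * R -> R) (c : R) :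
  compact K -> 0 < c -> continuous a -> continuous b ->
  (forall q, K q -> c * `|q.1| <= `|a q| /\ c * `|q.2| <= `|b q|) ->
  (mu2 R).-integrable (K : set (plane R)) (EFin \o (fun q => (hyp (a q) (b q))^-1)).
Proof.
move=> cK c0 ca cb le_ab.
have [M M0 KM] := compact_sub_square cK.
have mK : measurable (K : set (plane R)) := compact_measurable2 cK.
have KS : K `<=` square M.
  by move=> q /KM[h1 h2]; split; rewrite /= in_itv /= -ler_norml; exact: ltW.
pose g (q : R * R) := c^-1 * (invsqrt q.1 * invsqrt q.2).
have g0 q : 0 <= g q by rewrite mulr_ge0 ?invr_ge0 ?(ltW c0)// mulr_ge0// invsqrt_ge0.
have ig : (mu2 R).-integrable (K : set (plane R)) (EFin \o g).
  apply: (integrableS (measurable_square M) mK KS).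
  rewrite (_ : EFin \o g = (fun q => c^-1%:E * (EFin \o (fun q => invsqrt q.1 * invsqrt q.2)%R) q)%E).
    apply: integrableZl; first exact: measurable_square.
    exact: integrable_invsqrt_square.
  by apply/funext => q; rewrite /= -EFinM.
have mh : measurable_fun (K : set (plane R)) (fun q => (hyp (a q) (b q))^-1).
  by apply: measurable_funTS; exact: measurable_inv_hyp.
(* On the axes, the value 0 of the inverse of 0 spoils the inequality. *)
pose Z : set (plane R) := ([set 0] `*` setT) `|` (setT `*` [set 0]).
have m1 : measurable ([set 0] `*` setT : set (plane R)) by exact: measurableX.
have m2 : measurable (setT `*` [set 0] : set (plane R)) by exact: measurableX.
have Z0 : mu2 R Z = 0%E.
  have l0 : mu [set (0 : R)] = 0%E := lebesgue_measure_set1 0.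
  apply: null_set_setU => //.
    by apply: (eq_trans (product_measure1E _ _ _ _)) => //; rewrite [X in (X * _)%E]l0 mul0e.
  by apply: (eq_trans (product_measure1E _ _ _ _)) => //; rewrite [X in (_ * X)%E]l0 mule0.
apply/integrableP; split; first exact/measurable_EFinP.
apply: (@le_lt_trans _ _ (\int[mu2 R]_(q in K) (EFin \o g) q)%E); last first.
  by have /integrableP[_] := ig; under eq_integral do rewrite gee0_abs ?lee_fin//.
apply: ae_ge0_le_integral => //.
- by do 2 apply: measurableT_comp => //.
- by move=> q _; rewrite lee_fin.
- exact: (measurable_int (mu2 R)).
exists Z; split => //; first exact: measurableU.
move=> [x y] /= /not_implyP[Kq]; apply: contra_notP => nZ.
have x0 : x != 0 by apply/eqP => x0; apply: nZ; left; rewrite /= x0.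
have y0 : y != 0 by apply/eqP => y0; apply: nZ; right; rewrite /= y0.
have p0 : 0 < c * (Num.sqrt `|x| * Num.sqrt `|y|).
  by rewrite mulr_gt0// mulr_gt0// sqrtr_gt0 normr_gt0.
have le : c * (Num.sqrt `|x| * Num.sqrt `|y|) <= hyp (a (x, y)) (b (x, y)).
  rewrite -(@ler_pXn2r _ 2) ?nnegrE ?hyp_ge0 ?(ltW p0)// sqr_hyp.
  rewrite !exprMn !sqr_sqrtr// -(real_normK (num_real (a _))) -(real_normK (num_real (b _))).
  have [] := le_ab _ Kq; rewrite /=.
  move: (normr_ge0 x) (normr_ge0 y); move: `|x| `|y| `|a _| `|b _| => X Y A B *.
  apply: (@le_trans _ _ ((c * X) ^+ 2 + (c * Y) ^+ 2)); last first.
    by apply: lerD; rewrite ler_pXn2r ?nnegrE ?mulr_ge0 ?(ltW c0)//;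
       (apply: le_trans; last eassumption); rewrite mulr_ge0 ?(ltW c0).
  rewrite !exprMn -mulrDr; apply: ler_wpM2l; first exact: sqr_ge0.
  have := sqr_ge0 (X - Y); have XY : 0 <= X * Y by exact: mulr_ge0.
  rewrite sqrrB -mulr_natr; lra.
rewrite lee_fin ger0_norm ?invr_ge0 ?hyp_ge0// /g /invsqrt /= -!invfM.
by rewrite lef_pV2 ?posrE// (lt_le_trans p0).
Qed.

End inverse_distance.

(** * Horizontal area in coordinates *)

Section horizontal_area.
Context {R : realType}.
Implicit Types (F : R * R -> R3 R) (q : R * R) (p v w : R3 R).

(** The components on X and Y of the cross product of v and w. *)
Definition normalX v w : R := v.1.1 * w.1.2 - v.1.2 * w.1.1.
Definition normalY p v w : R :=
  (expR (- p.2) * (v.2 * w.1.1 - v.1.1 * w.2)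
   - expR p.2 * (v.1.2 * w.2 - v.2 * w.1.2)) / Num.sqrt 2.

Lemma sqrt2_neq0 : Num.sqrt 2 != 0 :> R.
Proof. by rewrite gt_eqF // sqrtr_gt0 ltr0n. Qed.

Lemma sqr_sqrt2 : Num.sqrt 2 ^+ 2 = 2 :> R.
Proof. by rewrite sqr_sqrtr // ler0n. Qed.

Lemma expR_neq0 (x : R) : expR x != 0.
Proof. by rewrite gt_eqF // expR_gt0. Qed.

Lemma mnorm_hproj p v :
  mnorm p (hproj p v) = hyp (metric p v (Xfield p)) (metric p v (Yfield p)).
Proof.
rewrite /mnorm /hyp; congr Num.sqrt.
have [[hX hY _] [hXY _ _]] := frame_orthonormal p.
rewrite /hproj; set A := metric p v _; set B := metric p v _.
have -> : metric p (A *: Xfield p + B *: Yfield p) (A *: Xfield p + B *: Yfield p) =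
    A ^+ 2 * metric p (Xfield p) (Xfield p) + B ^+ 2 * metric p (Yfield p) (Yfield p)
    + 2 * A * B * metric p (Xfield p) (Yfield p).
  by rewrite /metric /= /GRing.scale /=; ring.
by rewrite hX hY hXY !mulr1 mulr0 addr0.
Qed.

Lemma metric_crossX p v w : metric p (cross p v w) (Xfield p) = normalX v w.
Proof. by rewrite /metric /cross /normalX /=; ring. Qed.

Lemma metric_crossY p v w : metric p (cross p v w) (Yfield p) = normalY p v w.
Proof.
rewrite /metric /cross /normalY /= expRN.
by field; rewrite sqrt2_neq0 expR_neq0.
Qed.

Lemma metric_ge_hproj p v :
  metric p v (Xfield p) ^+ 2 + metric p v (Yfield p) ^+ 2 <= metric p v v.
Proof.
have -> : metric p v v = metric p v (Xfield p) ^+ 2 + metric p v (Yfield p) ^+ 2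
    + metric p v (Tfield p) ^+ 2.
  have h : 2 / Num.sqrt 2 ^+ 2 = 1 :> R by rewrite sqr_sqrt2 divff // pnatr_eq0.
  have -> : metric p v v = (2 / Num.sqrt 2 ^+ 2) * (expR (- p.2) ^+ 2 * (v.1.1 * v.1.1)
      + expR p.2 ^+ 2 * (v.1.2 * v.1.2)) + v.2 * v.2 by rewrite h mul1r.
  rewrite /metric /= expRN.
  by field; rewrite sqrt2_neq0 expR_neq0.
by rewrite lerDl sqr_ge0.
Qed.

Lemma metricZ (k : R) p v w : metric p (k *: v) w = k * metric p v w.
Proof. by rewrite /metric /= /GRing.scale /=; ring. Qed.

(** The normalization of the normal cancels against the area element; where the
    normal vanishes, so do its horizontal components. *)
Lemma horizontal_area_density F q :
  mnorm (F q) (hproj (F q) (unit_normal F q)) * area_element F q =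
  hyp (normalX (du F q) (dv F q)) (normalY (F q) (du F q) (dv F q)).
Proof.
rewrite mnorm_hproj /unit_normal /area_element -metric_cross -/(mnorm _ _).
rewrite -(metric_crossX (F q)) -metric_crossY.
set p := F q; set n := cross p _ _.
have [m0|m0] := eqVneq (mnorm p n) 0.
  rewrite m0 mulr0 /hyp ler0_sqrtr//; apply: le_trans (metric_ge_hproj p n) _.
  by move/eqP: m0; rewrite /mnorm sqrtr_eq0.
have m1 : 0 < mnorm p n by rewrite lt_def m0 sqrtr_ge0.
rewrite !metricZ -[RHS](mulVKf m0) mulrC; congr (_ * _).
rewrite /hyp !exprMn -mulrDr sqrtrM ?sqr_ge0// sqrtr_sqr ger0_norm//.
by rewrite invr_ge0 ltW.
Qed.

End horizontal_area.

(** * The calibration *)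

Section calibration.
Context {R : realType}.
Variables (y0 z0 e : R) (x y z : R * R -> R).
Hypotheses (e0 : 0 < e) (Cx : Ck 2 setT x) (Cy : Ck 2 setT y) (Cz : Ck 2 setT z).

Let c : R := expR z0.

(** Up to the factor exp(z), these are the components on X and Y of the normal
    vectors of the translates of the surface in the direction of x, at the point
    with coordinates y q and z q. *)
Definition calX (q : R * R) : R := c * (y q - y0).
Definition calY (q : R * R) : R := (expR (z0 - z q) - 1) / Num.sqrt 2.
Definition calnorm (q : R * R) : R :=
  Num.sqrt (calX q ^+ 2 + calY q ^+ 2 + e ^+ 2).

(** As a function of the coordinates y and z, this is a primitive in y of
    - exp(z) calY / (sqrt 2 calnorm), since the logarithm is an inverse hyperbolic
    sine of calX up to a function of z. *)
Definition calprim (q : R * R) : R :=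
  - (calY q * expR (z q) / (Num.sqrt 2 * c)) * ln (calX q + calnorm q).

(** The pull-back of the exact 2-form d calprim /\ dz - d(calnorm / c) /\ dx. *)
Definition calform (q : R * R) : R := jac calprim z q - c^-1 * jac calnorm x q.

Let oT : open [set: R * R] := openT.

Lemma calnorm_gt_norm q : `|calX q| < calnorm q.
Proof.
rewrite -sqrtr_sqr ltr_sqrt; last by rewrite ltr_wpDl ?exprn_gt0// addr_ge0// sqr_ge0.
by rewrite -addrA ltrDl ltr_wpDl ?exprn_gt0// sqr_ge0.
Qed.

Lemma calnorm_gt0 q : 0 < calnorm q.
Proof. exact: le_lt_trans (calnorm_gt_norm q). Qed.

Lemma calarg_gt0 q : 0 < calX q + calnorm q.
Proof. by have := calnorm_gt_norm q; rewrite ltr_norml -ltrBlDl sub0r => /andP[]; rewrite ltrNl. Qed.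

Lemma Ck_calX : Ck 2 setT calX.
Proof. exact: (CkM oT (Ck_cst _ (c : R) oT) (CkB oT Cy (Ck_cst _ (y0 : R) oT))). Qed.

Lemma Ck_calY : Ck 2 setT calY.
Proof.
exact: (CkM oT (CkB oT (Ck_exp oT (CkB oT (Ck_cst _ (z0 : R) oT) Cz))
  (Ck_cst _ (1 : R) oT)) (Ck_cst _ ((Num.sqrt 2)^-1 : R) oT)).
Qed.

Lemma Ck_calnorm : Ck 2 setT calnorm.
Proof.
have pos q : [set: R * R] q -> 0 < calX q * calX q + calY q * calY q + e ^+ 2.
  by move=> _; rewrite ltr_wpDl ?exprn_gt0// addr_ge0// -expr2 sqr_ge0.
exact: (Ck_sqrt oT pos (CkD oT (CkD oT (CkM oT Ck_calX Ck_calX) (CkM oT Ck_calY Ck_calY))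
  (Ck_cst _ (e ^+ 2 : R) oT))).
Qed.

Lemma Ck_calprim : Ck 2 setT calprim.
Proof.
have Cln : Ck 2 setT (fun q => ln (calX q + calnorm q)).
  exact: (Ck_ln oT (fun q _ => calarg_gt0 q) (CkD oT Ck_calX Ck_calnorm)).
exact: (CkM oT (CkN oT (CkM oT (CkM oT Ck_calY (Ck_exp oT Cz))
  (Ck_cst _ ((Num.sqrt 2 * c)^-1 : R) oT))) Cln).
Qed.

Let D (f : R * R -> R) (v : R * R) q := 'D_v f q.

Let dy q v : is_derive q v y (D y v q). Proof. by apply: derivableP; exact: (Ck_derivable Cy). Qed.
Let dz q v : is_derive q v z (D z v q). Proof. by apply: derivableP; exact: (Ck_derivable Cz). Qed.

Let is_derive_calX q v : is_derive q v calX (c * D y v q).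
Proof.
have h := is_derive_mul (is_derive_cst (c : R) q v) (is_derive_sub (dy q v) (is_derive_cst (y0 : R) q v)).
by apply: (is_derive_eq h); rewrite mulr0 addr0 subr0.
Qed.

Let is_derive_calY q v :
  is_derive q v calY (- (expR (z0 - z q) / Num.sqrt 2) * D z v q).
Proof.
have h1 := is_derive_chain (is_derive_sub (is_derive_cst (z0 : R) q v) (dz q v)) (is_derive_expR _).
have h := is_derive_mul (is_derive_sub h1 (is_derive_cst (1 : R) q v))
  (is_derive_cst ((Num.sqrt 2)^-1 : R) q v).
by apply: (is_derive_eq h); rewrite /=; ring.
Qed.

Let is_derive_calnorm q v : is_derive q v calnorm
  ((calX q * (c * D y v q) + calY q * (- (expR (z0 - z q) / Num.sqrt 2) * D z v q)) / calnorm q).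
Proof.
have hX := is_derive_calX q v; have hY := is_derive_calY q v.
have p0 : 0 < calX q * calX q + calY q * calY q + e ^+ 2.
  by rewrite ltr_wpDl ?exprn_gt0// addr_ge0// -expr2 sqr_ge0.
have h := is_derive_chain (is_derive_add (is_derive_add (is_derive_mul hX hX)
  (is_derive_mul hY hY)) (is_derive_cst (e ^+ 2 : R) q v)) (is_derive1_sqrt p0).
apply: (is_derive_eq h).
rewrite /= -!expr2 -/(calnorm q); have := calnorm_gt0 q; move: (calnorm q) => r r0.
by move: (calX q) (calY q) (D y v q) (- (_ / _) * _) => *; field; rewrite gt_eqF.
Qed.

Let is_derive_calprim q : exists k, forall v, is_derive q v calprim
  (- (calY q * expR (z q) / (Num.sqrt 2 * calnorm q)) * D y v q + k * D z v q).
Proof.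
pose b := - (expR (z0 - z q) / Num.sqrt 2).
exists (- ((b * expR (z q) + calY q * expR (z q)) / (Num.sqrt 2 * c) * ln (calX q + calnorm q)
  + calY q * expR (z q) / (Num.sqrt 2 * c) * (calY q * b / calnorm q / (calX q + calnorm q)))).
move=> v.
have hX := is_derive_calX q v; have hY := is_derive_calY q v.
have hn := is_derive_calnorm q v.
have hE := is_derive_chain (dz q v) (is_derive_expR _).
have hL := is_derive_chain (is_derive_add hX hn) (is_derive1_ln (calarg_gt0 q)).
have hP := is_derive_mul (is_derive_mul hY hE) (is_derive_cst ((Num.sqrt 2 * c)^-1 : R) q v).
have h := is_derive_mul (is_derive_sub (is_derive_cst (0 : R) q v) hP) hL.
have -> : calprim = (fun q => (0 - calY q * expR (z q) * (Num.sqrt 2 * c)^-1)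
    * ln (calX q + calnorm q)) by apply/funext => p; rewrite /calprim sub0r.
apply: (is_derive_eq h); rewrite /= -/b.
have := calnorm_gt0 q; have := calarg_gt0 q; have := @sqrt2_neq0 R; have := expR_neq0 z0.
rewrite -/c; move: c (Num.sqrt 2) (calnorm q) (calX q) (calY q) (D y v q) (D z v q) (expR (z q)).
move=> C s2 r A B Dy Dz Ez C0 s0 Ar0 r0; move: (ln _) => L; field.
by rewrite C0 s0 !gt_eqF.
Qed.

Let jacE (f g : R * R -> R) q f1 f2 g1 g2 :
  is_derive q ((1, 0) : R * R) f f1 -> is_derive q ((0, 1) : R * R) f f2 ->
  is_derive q ((1, 0) : R * R) g g1 -> is_derive q ((0, 1) : R * R) g g2 ->
  jac f g q = f1 * g2 - f2 * g1.
Proof. by rewrite /jac => -[_ ->] [_ ->] [_ ->] [_ ->]. Qed.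

(** The components on X and Y of the normal of the surface (x, y, z). *)
Let nX q := jac x y q.
Let nY q := (expR (- z q) * jac z x q - expR (z q) * jac y z q) / Num.sqrt 2.

(** In d calprim /\ dz only the derivative of calprim in the direction of y
    survives, and d calnorm is computed from calnorm^2. *)
Lemma calformE q : calform q = (calX q * nX q + calY q * nY q) / calnorm q.
Proof.
have [k hk] := is_derive_calprim q.
rewrite /calform (jacE (hk _) (hk _) (dz q _) (dz q _)).
have dx v : is_derive q v x (D x v q).
  by apply: derivableP; exact: (Ck_derivable Cx).
rewrite (jacE (is_derive_calnorm q _) (is_derive_calnorm q _) (dx _) (dx _)).
rewrite /nX /nY (jacE (dx _) (dx _) (dy q _) (dy q _)) (jacE (dz q _) (dz q _) (dx _) (dx _)).
rewrite (jacE (dy q _) (dy q _) (dz q _) (dz q _)) expRB expRN -/c.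
have := calnorm_gt0 q; have := @sqrt2_neq0 R; have := expR_neq0 z0; have := expR_neq0 (z q).
rewrite -/c; move: c (Num.sqrt 2) (calnorm q) (calX q) (calY q) (expR (z q)).
move: (D x _ q) (D x _ q) (D y _ q) (D y _ q) (D z _ q) (D z _ q).
move=> x1 x2 y1 y2 z1 z2 C s2 r A B Ez Ez0 C0 s0 r0; field.
by rewrite C0 s0 Ez0 gt_eqF.
Qed.

(** The form is the scalar product of the normal with a horizontal field of
    length less than 1. *)
Lemma calform_le q : calform q <= hyp (nX q) (nY q).
Proof.
rewrite calformE ler_pdivrMr ?calnorm_gt0//.
apply: (le_trans (ler_norm _)).
rewrite -(@ler_pXn2r _ 2) ?nnegrE ?mulr_ge0 ?hyp_ge0 ?(ltW (calnorm_gt0 _))//.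
rewrite real_normK ?num_real// exprMn sqr_hyp /calnorm sqr_sqrtr; last first.
  by rewrite addr_ge0 ?sqr_ge0// addr_ge0 ?sqr_ge0.
move: (nX q) (nY q) (calX q) (calY q) => a b A B.
have h1 := sqr_ge0 (A * b - B * a); have h2 : 0 <= (a ^+ 2 + b ^+ 2) * e ^+ 2.
  by rewrite mulr_ge0 ?sqr_ge0// addr_ge0 ?sqr_ge0.
rewrite -subr_ge0; have -> : (a ^+ 2 + b ^+ 2) * (A ^+ 2 + B ^+ 2 + e ^+ 2) - (A * a + B * b) ^+ 2
  = (A * b - B * a) ^+ 2 + (a ^+ 2 + b ^+ 2) * e ^+ 2 by ring.
exact: addr_ge0.
Qed.

(** The hypotheses hold on the leaves of the foliation; there only the
    regularization is lost. *)
Lemma calform_ge q : nX q = expR (z q) * calX q -> nY q = expR (z q) * calY q ->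
  hyp (nX q) (nY q) - e * expR (z q) <= calform q.
Proof.
move=> hX hY; rewrite calformE hX hY.
have r0 := calnorm_gt0 q; have Ez := expR_gt0 (z q).
set h := hyp (calX q) (calY q).
have h0 : 0 <= h := hyp_ge0 _ _.
have -> : hyp (expR (z q) * calX q) (expR (z q) * calY q) = expR (z q) * h.
  by rewrite /h /hyp !exprMn -mulrDr sqrtrM ?sqr_ge0// sqrtr_sqr ger0_norm// ltW.
have -> : calX q * (expR (z q) * calX q) + calY q * (expR (z q) * calY q) =
    expR (z q) * h ^+ 2 by rewrite sqr_hyp; ring.
rewrite (mulrC e) -mulrBr -mulrA; apply: ler_wpM2l; first exact: ltW.
have rE : calnorm q ^+ 2 = h ^+ 2 + e ^+ 2.
  by rewrite sqr_hyp sqr_sqrtr// addr_ge0 ?sqr_ge0// addr_ge0 ?sqr_ge0.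
have hr : h <= calnorm q.
  by rewrite -(@ler_pXn2r _ 2) ?nnegrE ?(ltW r0)// rE lerDl sqr_ge0.
have rhe : calnorm q <= h + e.
  rewrite -(@ler_pXn2r _ 2) ?nnegrE ?(ltW r0) ?addr_ge0 ?(ltW e0)// rE sqrrD.
  by rewrite lerD2r lerDl mulrn_wge0// mulr_ge0// ltW.
rewrite ler_pdivlMr// mulrBl lerBlDr.
move: hr rhe r0 h0; move: (calnorm q) => r hr rhe r0 h0.
have := ler_wpM2l (ltW r0) rhe; nra.
Qed.

End calibration.

Lemma eq_calnorm {R : realType} (y0 z0 e : R) (y y' z z' : R * R -> R) q :
  y q = y' q -> z q = z' q -> calnorm y0 z0 e y z q = calnorm y0 z0 e y' z' q.
Proof. by rewrite /calnorm /calX /calY => -> ->. Qed.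

Lemma eq_calprim {R : realType} (y0 z0 e : R) (y y' z z' : R * R -> R) q :
  y q = y' q -> z q = z' q -> calprim y0 z0 e y z q = calprim y0 z0 e y' z' q.
Proof. by rewrite /calprim /calnorm /calX /calY => -> ->. Qed.

(** * A global chart of the surface *)

Section coordinates.
Context {R : realType} {V : normedModType R}.

Lemma continuous_coordx : continuous (fun p : R3 R => p.1.1).
Proof. by move=> p; apply: (@continuous_comp _ _ _ fst fst); exact: cvg_fst. Qed.

Lemma continuous_coordy : continuous (fun p : R3 R => p.1.2).
Proof.
by move=> p; apply: (@continuous_comp _ _ _ fst snd); [exact: cvg_fst|exact: cvg_snd].
Qed.

Lemma continuous_coordz : continuous (fun p : R3 R => p.2).
Proof. by move=> p; exact: cvg_snd. Qed.

Lemma Ck_coord n (D : set V) (f : V -> R3 R) : open D -> Ck n D f ->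
  [/\ Ck n D (fun p => (f p).1.1), Ck n D (fun p => (f p).1.2) & Ck n D (fun p => (f p).2)].
Proof.
move=> oD Cf; split.
- exact: (Ck_linear continuous_coordx (fun _ _ _ => erefl) oD Cf).
- exact: (Ck_linear continuous_coordy (fun _ _ _ => erefl) oD Cf).
- exact: (Ck_linear continuous_coordz (fun _ _ _ => erefl) oD Cf).
Qed.

Lemma derive_coord (f : V -> R3 R) q v : derivable f q v ->
  'D_v f q = ('D_v (fun p => (f p).1.1) q, 'D_v (fun p => (f p).1.2) q, 'D_v (fun p => (f p).2) q).
Proof.
move=> /derivableP df.
have [_ ->] := is_derive_linear continuous_coordx (fun _ _ _ => erefl) df.
have [_ ->] := is_derive_linear continuous_coordy (fun _ _ _ => erefl) df.
have [_ ->] := is_derive_linear continuous_coordz (fun _ _ _ => erefl) df.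
by case: ('D_v f q) => -[].
Qed.

End coordinates.

Section chart.
Context {R : realType}.
Variables (x0 y0 z0 : R).

(** Centered so that the only singular point of the surface is the image of
    the origin. *)
Definition chart (q : R * R) : R3 R :=
  (x0 - expR (q.2 + 2 * z0) * q.1, y0 + q.1, z0 + q.2).

Let oT : open [set: R * R] := openT.

Lemma Ck_fst n : Ck n [set: R * R] (fun q : R * R => q.1).
Proof. by apply: (Ck_linear _ _ oT (Ck_id n oT)) => // q; exact: cvg_fst. Qed.

Lemma Ck_snd n : Ck n [set: R * R] (fun q : R * R => q.2).
Proof. by apply: (Ck_linear _ _ oT (Ck_id n oT)) => // q; exact: cvg_snd. Qed.

Lemma Ck_chart n : Ck n setT chart.
Proof.
have cst (k : R) : Ck n [set: R * R] (fun=> k) := Ck_cst n k oT.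
have Cx := CkB oT (cst x0) (CkM oT (Ck_exp oT (CkD oT (Ck_snd n) (cst (2 * z0)))) (Ck_fst n)).
exact: (Ck_pair oT (Ck_pair oT Cx (CkD oT (cst y0) (Ck_fst n))) (CkD oT (cst z0) (Ck_snd n))).
Qed.

Lemma is_derive_chart q (v : R * R) : is_derive q v chart
  (- (expR (q.2 + 2 * z0) * (v.2 * q.1 + v.1)), v.1, v.2).
Proof.
have d1 : is_derive q v (fun q : R * R => q.1) v.1.
  by apply: (is_derive_linear _ _ (is_derive_id q v)) => // p; exact: cvg_fst.
have d2 : is_derive q v (fun q : R * R => q.2) v.2.
  by apply: (is_derive_linear _ _ (is_derive_id q v)) => // p; exact: cvg_snd.
have cst (k : R) := is_derive_cst k q v.
have dE := is_derive_chain (is_derive_add d2 (cst (2 * z0))) (is_derive_expR _).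
have dx := is_derive_sub (cst x0) (is_derive_mul dE d1).
have h := is_derive_pair (is_derive_pair dx (is_derive_add (cst y0) d1)) (is_derive_add (cst z0) d2).
apply: (is_derive_eq h); congr (_, _, _) => /=; ring.
Qed.

Lemma global_chart_chart : global_chart chart
  [set p : R * R * R | expR (p.2 + z0) * (p.1.2 - y0) + p.1.1 - x0 = 0].
Proof.
split.
- by apply: Ck_smooth_on => n; exact: Ck_chart.
- move=> q a b; rewrite /du /dv.
  have [_ ->] := is_derive_chart q (1, 0); have [_ ->] := is_derive_chart q (0, 1).
  by move=> [_ /=]; rewrite /GRing.scale /= !mulr1 !mulr0 addr0 add0r.
- apply/seteqP; split => [_ [q _ <-]|[[x y] z] /= h] /=.
    rewrite (addrC y0) addrK (_ : z0 + q.2 + z0 = q.2 + 2 * z0); last by ring.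
    by rewrite addrCA subrr addr0 subrr.
  exists (y - y0, z - z0) => //; rewrite /chart /=; congr (_, _, _).
  + by rewrite (_ : z - z0 + 2 * z0 = z + z0); [lra|ring].
  + by rewrite addrC subrK.
  + by rewrite addrC subrK.
exists (fun p => (p.1.2 - y0, p.2 - z0)); split.
  by move=> [u v] /=; rewrite (addrC y0) (addrC z0) !addrK.
apply: continuous_subspaceT => p.
have h1 : (fun p : R3 R => p.1.2 - y0) @ p --> p.1.2 - y0.
  by apply: cvgB; [exact: continuous_coordy|exact: cvg_cst].
have h2 : (fun p : R3 R => p.2 - z0) @ p --> p.2 - z0.
  by apply: cvgB; [exact: continuous_coordz|exact: cvg_cst].
exact: (cvg_pair h1 h2).
Qed.

End chart.

(** * The area of the varied surfaces *)

Section varied.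
Context {R : realType}.
Notation V := (R * (R * R))%type.
Variables (x0 y0 z0 : R).
Notation chart0 := (chart x0 y0 z0).
Variables (eps : R) (K : set (R * R)) (Psi : R -> R * R -> R3 R).
Hypothesis var : Defs.variation chart0 eps K Psi.

Let e1 : R * R := (1, 0).
Let e2 : R * R := (0, 1).

Let eps0 : 0 < eps. Proof. by case: var => -[]. Qed.
Let cK : compact K. Proof. by case: var => -[]. Qed.
Let small0 : `|0 : R| < eps. Proof. by rewrite normr0. Qed.

Let oS : open (strip eps : set V) := @open_strip R eps.

Let X (p : V) : R := (Psi p.1 p.2).1.1.
Let Y (p : V) : R := (Psi p.1 p.2).1.2.
Let Z (p : V) : R := (Psi p.1 p.2).2.

Let CPsi n : Ck n (strip eps) (fun p : V => Psi p.1 p.2).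
Proof. by case: var => _ sPsi _ _ _; exact: smooth_on_Ck. Qed.

Let CX n : Ck n (strip eps) X. Proof. by have [] := Ck_coord oS (CPsi n). Qed.
Let CY n : Ck n (strip eps) Y. Proof. by have [] := Ck_coord oS (CPsi n). Qed.
Let CZ n : Ck n (strip eps) Z. Proof. by have [] := Ck_coord oS (CPsi n). Qed.

Let jacV (f g : V -> R) (p : V) : R :=
  'D_((0, e1) : V) f p * 'D_((0, e2) : V) g p - 'D_((0, e2) : V) f p * 'D_((0, e1) : V) g p.

Let Ck_jacV n (f g : V -> R) : Ck n.+1 (strip eps) f -> Ck n.+1 (strip eps) g ->
  Ck n (strip eps) (jacV f g).
Proof.
move=> Cf Cg.
exact: (CkB oS (CkM oS (Ck_derive (0, e1) Cf) (Ck_derive (0, e2) Cg))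
  (CkM oS (Ck_derive (0, e2) Cf) (Ck_derive (0, e1) Cg))).
Qed.

Let jac_slice (f g : V -> R) s q :
  jac (fun q => f (s, q)) (fun q => g (s, q)) q = jacV f g (s, q).
Proof. by rewrite /jac /jacV !derive_slice. Qed.

(** The components of the normal of the surface with parameter p.1. *)
Let a : V -> R := jacV X Y.
Let b (p : V) : R :=
  (expR (- Z p) * jacV Z X p - expR (Z p) * jacV Y Z p) / Num.sqrt 2.

Let Ca n : Ck n (strip eps) a. Proof. by apply: Ck_jacV; [exact: CX|exact: CY]. Qed.
Let Cb n : Ck n (strip eps) b.
Proof.
have CZ1 := CZ n; have jZX := Ck_jacV (CZ n.+1) (CX n.+1); have jYZ := Ck_jacV (CY n.+1) (CZ n.+1).
exact: (CkM oS (CkB oS (CkM oS (Ck_exp oS (CkN oS CZ1)) jZX) (CkM oS (Ck_exp oS CZ1) jYZ))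
  (Ck_cst n ((Num.sqrt 2)^-1 : R) oS)).
Qed.

Let normal_slice s q : `|s| < eps ->
  normalX (du (Psi s) q) (dv (Psi s) q) = a (s, q) /\
  normalY (Psi s q) (du (Psi s) q) (dv (Psi s) q) = b (s, q).
Proof.
move=> se.
have CPs : Ck 1 [set q | strip eps ((s, q) : V)] (Psi s) := Ck_slice s oS (CPsi 1).
have dPs v : derivable (Psi s) q v.
  by have := se : [set q | strip eps ((s, q) : V)] q; exact: (Ck_derivable CPs).
rewrite /normalX /normalY /du /dv !derive_coord//=.
rewrite /b /a -!jac_slice /jac -/e1 -/e2.
rewrite -/(Z (s, q)) /X /Y /Z /=.
move: ('D_e1 _ q) ('D_e2 _ q) ('D_e1 _ q) ('D_e2 _ q) ('D_e1 _ q) ('D_e2 _ q) (Psi s q).2.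
by move=> *; split; [|congr (_ / _)]; ring.
Qed.

Lemma varied_areaE s : `|s| < eps ->
  varied_area K Psi s = Rintegral (mu2 R) K (fun q => hyp (a (s, q)) (b (s, q))).
Proof.
move=> se; apply: eq_Rintegral => q _; rewrite horizontal_area_density.
by have [-> ->] := normal_slice q se.
Qed.

Let Psi0 q : Psi 0 q = chart0 q. Proof. by case: var. Qed.

Let a0 q : a (0, q) = expR (q.2 + 2 * z0) * q.1.
Proof.
have [<- _] := normal_slice q small0.
have -> : Psi 0 = chart0 by apply/funext.
rewrite /normalX /du /dv.
have [_ ->] := is_derive_chart x0 y0 z0 q e1; have [_ ->] := is_derive_chart x0 y0 z0 q e2.
by rewrite /=; ring.
Qed.

Let b0 q : b (0, q) = (expR z0 - expR (z0 + q.2)) / Num.sqrt 2.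
Proof.
have [_ <-] := normal_slice q small0.
have -> : Psi 0 = chart0 by apply/funext.
rewrite /normalY /du /dv.
have [_ ->] := is_derive_chart x0 y0 z0 q e1; have [_ ->] := is_derive_chart x0 y0 z0 q e2.
rewrite /=; congr (_ / _).
rewrite (_ : expR z0 = expR (- (z0 + q.2)) * expR (q.2 + 2 * z0)); first by ring.
by rewrite -expRD; congr expR; ring.
Qed.

Let zero0 q : a (0, q) = 0 -> b (0, q) = 0 -> q = (0, 0).
Proof.
rewrite a0 b0 => /eqP; rewrite mulf_eq0 (negbTE (expR_neq0 _)) /= => /eqP q1.
move=> /eqP; rewrite mulf_eq0 invr_eq0 (negbTE sqrt2_neq0) orbF subr_eq0 => /eqP/expR_inj e.
by move: q1 e; case: q => u v /= -> e; congr pair; lra.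
Qed.

Let slope0 : 'D_((0, (0, 1)) : V) b (0, (0, 0)) != 0.
Proof.
rewrite -derive_slice.
have -> : (fun q => b (0, q)) = (fun q => (expR z0 - expR (z0 + q.2)) * (Num.sqrt 2)^-1).
  by apply/funext => q; exact: b0.
have d2 : is_derive ((0, 0) : R * R) e2 (fun q : R * R => q.2) 1.
  by apply: (is_derive_linear _ _ (is_derive_id ((0, 0) : R * R) e2)) => // p; exact: cvg_snd.
have cst (k : R) := is_derive_cst k ((0, 0) : R * R) e2.
have dE := is_derive_chain (is_derive_add (cst z0) d2) (is_derive_expR _).
have [_ ->] := is_derive_mul (is_derive_sub (cst (expR z0)) dE) (cst (Num.sqrt 2)^-1).
rewrite /= mulr0 !add0r mulr1 mulrN oppr_eq0.
by rewrite mulf_neq0 ?expR_neq0// invr_eq0 sqrt2_neq0.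
Qed.

Let expR_dist (v M : R) : `|v| <= M -> expR (- M) * `|v| <= `|1 - expR v|.
Proof.
rewrite ler_norml => /andP[Mv vM].
have E1 : expR (- M) <= 1 by rewrite -expR0 ler_expR oppr_le0; lra.
have [v0|v0] := leP 0 v.
  have h := expR_ge1Dx v.
  rewrite (ger0_norm v0) distrC ger0_norm; last lra.
  apply: (@le_trans _ _ (1 * v)); first exact: ler_wpM2r.
  lra.
have h := expR_ge1Dx (- v).
have E2 : expR (- M) <= expR v by rewrite ler_expR.
have Ev : expR v * expR (- v) = 1 by rewrite -expRD subrr expR0.
rewrite (ltr0_norm v0) ger0_norm; last first.
  by rewrite subr_ge0 -expR0 ler_expR ltW.
apply: (@le_trans _ _ (expR v * - v)); first by apply: ler_wpM2r => //; rewrite oppr_ge0 ltW.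
have := ler_wpM2l (ltW (expR_gt0 v)) h; rewrite mulrDr Ev mulr1; lra.
Qed.

(** The singular point is nondegenerate: the horizontal normal vanishes to first
    order there. *)
Let int0 : (mu2 R).-integrable (K : set (plane R))
  (EFin \o (fun q => (hyp (a (0, q)) (b (0, q)))^-1)).
Proof.
have [M M0 KM] := compact_sub_square cK.
pose c1 := expR (- M + 2 * z0); pose c2 := expR z0 * expR (- M) / Num.sqrt 2.
have c20 : 0 < c2 by rewrite divr_gt0 ?mulr_gt0 ?expR_gt0// sqrtr_gt0.
apply: (@integrable_inv_hyp _ _ (fun q => a (0, q)) (fun q => b (0, q)) (Num.min c1 c2)).
- exact: cK.
- by rewrite lt_min expR_gt0.
- exact: continuous_frozen (Ca 0) small0.
- exact: continuous_frozen (Cb 0) small0.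
move=> q /KM[q1 q2]; rewrite a0 b0; split.
  rewrite normrM (ger0_norm (ltW (expR_gt0 _))); apply: ler_wpM2r => //.
  apply: (@le_trans _ _ c1); first by rewrite ge_min lexx.
  rewrite ler_expR lerD2r; move: (ltW q2); rewrite ler_norml => /andP[+ _].
  by [].
rewrite expRD -[X in X - _]mulr1 -mulrBr !normrM (ger0_norm (ltW (expR_gt0 z0))).
rewrite normfV (ger0_norm (sqrtr_ge0 _)).
apply: (@le_trans _ _ (c2 * `|q.2|)).
  by apply: ler_wpM2r => //; rewrite ge_min lexx orbT.
rewrite /c2 mulrAC; apply: ler_wpM2r; first by rewrite invr_ge0 sqrtr_ge0.
rewrite -mulrA; apply: ler_wpM2l; first exact: ltW (expR_gt0 _).
exact: expR_dist (ltW q2).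
Qed.

Let outside s q : `|s| < eps -> ~ K q ->
  [/\ X (s, q) = X (0, q), Y (s, q) = Y (0, q) & Z (s, q) = Z (0, q)].
Proof.
by case: var => _ _ _ _ eqF se Kq; rewrite /X /Y /Z /= Psi0 eqF.
Qed.

Let closedK : closed K.
Proof. by apply: compact_closed cK; exact: norm_hausdorff. Qed.

Let jac_outside (f g : V -> R) s q : `|s| < eps -> ~ K q ->
  (forall q, ~ K q -> f (s, q) = f (0, q) /\ g (s, q) = g (0, q)) ->
  jacV f g (s, q) = jacV f g (0, q).
Proof.
move=> se Kq fg; rewrite -!jac_slice /jac.
have nearK := open_nbhs_nbhs (conj (closed_openC closedK) Kq).
have ef v : 'D_v (fun q => f (s, q)) q = 'D_v (fun q => f (0, q)) q.
  by apply: near_eq_derive; apply: filterS nearK => y /fg[].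
have eg v : 'D_v (fun q => g (s, q)) q = 'D_v (fun q => g (0, q)) q.
  by apply: near_eq_derive; apply: filterS nearK => y /fg[].
by rewrite !ef !eg.
Qed.

Let ab_outside s q : `|s| < eps -> ~ K q -> a (s, q) = a (0, q) /\ b (s, q) = b (0, q).
Proof.
move=> se Kq; have [eX eY eZ] := outside se Kq.
split; first by apply: jac_outside => // y /(outside se)[].
rewrite /b eZ (jac_outside (f := Z) (g := X) se Kq); last by move=> y /(outside se)[].
by rewrite (jac_outside (f := Y) (g := Z) se Kq)// => y /(outside se)[].
Qed.

Let integrableN s (L : set (R * R)) : `|s| < eps -> compact L ->
  (mu2 R).-integrable (L : set (plane R)) (EFin \o (fun q => hyp (a (s, q)) (b (s, q)))).
Proof.
move=> se cL; apply: continuous_integrable2 => // q.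
exact: cvg_hyp (continuous_frozen (Ca 0) se (x := q)) (continuous_frozen (Cb 0) se (x := q)).
Qed.

Let slice_T s n (f : V -> R) : `|s| < eps -> Ck n (strip eps) f -> Ck n setT (fun q => f (s, q)).
Proof.
move=> se Cf; rewrite (_ : setT = [set q | strip eps ((s, q) : V)]); first exact: Ck_slice.
by apply/seteqP; split.
Qed.

(** The calibration argument. The area is at least the integral of the
    calibrating form, which does not depend on s by Stokes' formula and which for
    s = 0 falls short of the area by at most a multiple of e. *)
Let square_area_min s M : `|s| < eps -> 0 < M ->
  (forall q, K q -> `|q.1| < M /\ `|q.2| < M) ->
  Rintegral (mu2 R) (square M) (fun q => hyp (a (0, q)) (b (0, q))) <=
  Rintegral (mu2 R) (square M) (fun q => hyp (a (s, q)) (b (s, q))).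
Proof.
move=> se M0 KM.
have cS := @compact_square R M; have mS := measurable_square M.
pose om e r := calform y0 z0 e (fun q => X (r, q)) (fun q => Y (r, q)) (fun q => Z (r, q)).
have Csl r n : `|r| < eps -> [/\ Ck n setT (fun q => X (r, q)),
    Ck n setT (fun q => Y (r, q)) & Ck n setT (fun q => Z (r, q))].
  by move=> re; split; apply: slice_T.
have com e r : 0 < e -> `|r| < eps -> continuous (om e r).
  move=> e0 re q; have [Cx Cy Cz] := Csl r 2 re.
  have h1 := continuous_jac (CkS (Ck_calprim y0 z0 e0 Cy Cz)) (CkS Cz).
  have h2 := continuous_jac (CkS (Ck_calnorm y0 z0 e0 Cy Cz)) (CkS Cx).
  exact: (cvgB (h1 q) (cvgM (cvg_cst _) (h2 q))).
have iom e r (e0 : 0 < e) (re : `|r| < eps) :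
    (mu2 R).-integrable (square M : set (plane R)) (EFin \o om e r).
  exact: continuous_integrable2 cS (com e r e0 re).
have stokes e : 0 < e ->
    Rintegral (mu2 R) (square M) (om e s) = Rintegral (mu2 R) (square M) (om e 0).
  move=> e0; have [Cx Cy Cz] := Csl s 2 se; have [Cx0 Cy0 Cz0] := Csl 0 2 small0.
  have Cp := Ck_calprim y0 z0 e0 Cy Cz; have Cp0 := Ck_calprim y0 z0 e0 Cy0 Cz0.
  have Cn := Ck_calnorm y0 z0 e0 Cy Cz; have Cn0 := Ck_calnorm y0 z0 e0 Cy0 Cz0.
  have J1 := integral_jac_eq M0 closedK KM (CkS Cp0) (CkS Cp) Cz0 Cz.
  have J2 := integral_jac_eq M0 closedK KM (CkS Cn0) (CkS Cn) Cx0 Cx.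
  have ij f g : Ck 2 setT f -> Ck 2 setT g ->
      (mu2 R).-integrable (square M : set (plane R)) (EFin \o jac f g).
    by move=> Cf Cg; apply: continuous_integrable2 cS _; apply: continuous_jac; exact: CkS.
  have split_om r f g : Ck 2 setT f -> Ck 2 setT g -> Ck 2 setT (fun q => Z (r, q)) ->
      Ck 2 setT (fun q => X (r, q)) ->
      Rintegral (mu2 R) (square M) (fun q => jac f (fun q => Z (r, q)) q -
        (expR z0)^-1 * jac g (fun q => X (r, q)) q) =
      Rintegral (mu2 R) (square M) (jac f (fun q => Z (r, q))) -
      (expR z0)^-1 * Rintegral (mu2 R) (square M) (jac g (fun q => X (r, q))).
    move=> Cf Cg CZr CXr.
    have i1 := ij _ _ Cf CZr; have i2 := ij _ _ Cg CXr.
    have i3 : (mu2 R).-integrable (square M : set (plane R))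
        (EFin \o (fun q => (expR z0)^-1 * jac g (fun q => X (r, q)) q)).
      exact: (integrableZl mS (expR z0)^-1 i2).
    by rewrite (RintegralB mS i1 i3) (RintegralZl _ mS i2).
  pose Ys r q := Y (r, q); pose Zs r q := Z (r, q).
  have eX q : ~ K q -> X (0, q) = X (s, q) by move=> /(outside se)[h _ _]; exact: esym h.
  have eY q : ~ K q -> Ys 0 q = Ys s q by move=> /(outside se)[_ h _]; exact: esym h.
  have eZ q : ~ K q -> Zs 0 q = Zs s q by move=> /(outside se)[_ _ h]; exact: esym h.
  have H1 := J1 (fun q Kq => conj (eq_calprim y0 z0 e (eY q Kq) (eZ q Kq)) (eZ q Kq)).
  have H2 := J2 (fun q Kq => conj (eq_calnorm y0 z0 e (eY q Kq) (eZ q Kq)) (eX q Kq)).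
  apply: (eq_trans (split_om s _ _ Cp Cn Cz Cx)).
  apply: (eq_trans _ (esym (split_om 0 _ _ Cp0 Cn0 Cz0 Cx0))).
  by rewrite H1 H2.
have N0 := integrableN small0 cS; have Ns := integrableN se cS.
pose C := expR (z0 + M) * fine (mu2 R (square M : set (plane R))).
suff main e : 0 < e ->
    Rintegral (mu2 R) (square M) (fun q => hyp (a (0, q)) (b (0, q))) - e * C <=
    Rintegral (mu2 R) (square M) (fun q => hyp (a (s, q)) (b (s, q))).
  apply/ler_addgt0Pr => d d0.
  have C0 : 0 <= C by rewrite mulr_ge0 ?expR_ge0// fine_ge0.
  have dC : 0 < d / (C + 1) by rewrite divr_gt0// ltr_wpDl.
  have := main _ dC; rewrite lerBlDr => /le_trans; apply; rewrite lerD2l.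
  rewrite mulrAC ler_pdivrMr ?ltr_wpDl//; apply: ler_wpM2l; first exact: ltW.
  by rewrite lerDl.
move=> e0; apply: (@le_trans _ _ (Rintegral (mu2 R) (square M) (om e s))); last first.
  apply: le_Rintegral => //; first exact: iom.
  move=> q _; have [Cx Cy Cz] := Csl s 2 se.
  have := calform_le y0 z0 e0 Cx Cy Cz q.
  by rewrite /b /a -!jac_slice.
rewrite stokes//.
have icst : (mu2 R).-integrable (square M : set (plane R)) (EFin \o (fun=> e * expR (z0 + M))).
  by apply: continuous_integrable2 cS _ => q; exact: cvg_cst.
rewrite /C mulrA -(Rintegral_cst _ mS) -RintegralB//.
apply: le_Rintegral => //; last 1 first.
- move=> q [_ /=]; rewrite in_itv /= => /andP[_ qM].
  have [Cx Cy Cz] := Csl 0 2 small0.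
  have ZE : Z (0, q) = z0 + q.2 by rewrite /Z /= Psi0.
  have YE : Y (0, q) = y0 + q.1 by rewrite /Y /= Psi0.
  have := @calform_ge _ y0 z0 e _ _ _ e0 Cx Cy Cz q; rewrite -/(om e 0 q) !jac_slice -/(a _).
  rewrite -/(b (0, q)) a0 b0 /calX /calY ZE YE => h.
  rewrite -[leRHS]/(om e 0 q); apply: le_trans (h _ _).
  + by rewrite lerD2l lerN2; apply: ler_wpM2l; [exact: ltW|rewrite ler_expR lerD2l].
  + rewrite addrAC subrr add0r mulrA -expRD; congr (expR _ * _); ring.
  + rewrite mulrA mulrBr mulr1 -expRD; congr ((expR _ - _) / _); ring.
- rewrite (_ : _ \o _ = (fun q => (EFin \o (fun q => hyp (a (0%R, q)) (b (0%R, q)))) q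
     - (EFin \o (fun=> (e * expR (z0 + M))%R)) q)%E) //.
  exact: integrableB.
- exact: iom.
Qed.

(** Outside K the surfaces coincide, so that K may be replaced by a square, to
    which Stokes' formula applies. *)
Lemma varied_area_min s : `|s| < eps -> varied_area K Psi 0 <= varied_area K Psi s.
Proof.
move=> se; rewrite (varied_areaE small0) (varied_areaE se).
have [M M0 KM] := compact_sub_square cK.
have mK : measurable (K : set (plane R)) := compact_measurable2 cK.
have mS := @measurable_square R M.
have KS : K `<=` square M.
  by move=> q /KM[h1 h2]; split; rewrite /= in_itv /= -ler_norml; exact: ltW.
have := square_area_min se M0 KM.
have SE : (square M : set (plane R)) = K `|` (square M `\` K).
  by rewrite setDE setUIr setUv setIT; apply/esym/setUidPr.
have mD : measurable (square M `\` K : set (plane R)) by exact: measurableD.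
have dis : [disjoint K & square M `\` K] by apply/disj_setPS => q [Kq [_]].
have spl r : `|r| < eps -> Rintegral (mu2 R) (square M) (fun q => hyp (a (r, q)) (b (r, q))) =
    Rintegral (mu2 R) K (fun q => hyp (a (r, q)) (b (r, q))) +
    Rintegral (mu2 R) (square M `\` K) (fun q => hyp (a (r, q)) (b (r, q))).
  move=> re; rewrite {1}SE Rintegral_setU// -SE.
  exact: integrableN re (@compact_square R M).
rewrite (spl _ se) (spl _ small0).
have e : Rintegral (mu2 R) (square M `\` K) (fun q => hyp (a (s, q)) (b (s, q))) =
    Rintegral (mu2 R) (square M `\` K) (fun q => hyp (a (0, q)) (b (0, q))).
  apply: eq_Rintegral => q /set_mem[_ Kq].
  by have [-> ->] := ab_outside se Kq.
by rewrite e lerD2r.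
Qed.

Lemma varied_area_derivatives : exists r A1 l, [/\ 0 < r,
  forall s : R, `|s| < r -> is_derive s 1 (varied_area K Psi) (A1 s),
  is_derive (0 : R) 1 A1 l, A1 0 = 0 & 0 <= l].
Proof.
have [r [A1 [l [r0 dA dA1]]]] := integrated_length_twice_derivable cK eps0 (Ca 2) (Cb 2) zero0 slope0 int0.
pose r' := Num.min r eps.
have r'0 : 0 < r' by rewrite lt_min r0.
have lt_r s : `|s| < r' -> `|s| < r /\ `|s| < eps by rewrite lt_min => /andP[].
have dA' (s : R) : `|s| < r' -> is_derive s 1 (varied_area K Psi) (A1 s).
  move=> /lt_r[sr se]; apply: near_eq_is_derive (dA s sr).
  have := open_nbhs_nbhs (conj (open_comp (fun x _ => @norm_continuous _ _ x) (@open_lt R eps)) se).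
  by apply: filterS => t te; rewrite varied_areaE.
have [|A10 l0] := derivatives_at_min r'0 dA' dA1; last by exists r', A1, l.
by move=> s /lt_r[_ se]; exact: varied_area_min.
Qed.

End varied.

Lemma area_stable_chart {R : realType} (x0 y0 z0 : R) : area_stable (chart x0 y0 z0).
Proof.
split => [eps K Psi var|eps K Psi var A]; have [r [A1 [l [r0 dA dA1 A10 l0]]]] :=
    varied_area_derivatives var.
  by have := dA 0; rewrite normr0 A10; apply.
have near_r : \forall s \near (0 : R), `|s| < r.
  by have := @nbhsx_ballx _ _ (0 : R) r r0; apply: filterS => s; rewrite /ball /= sub0r normrN.
have A1E : \forall s \near (0 : R), A1 s = derive1 A s.
  by apply: filterS near_r => s /dA[_ <-]; rewrite derive1E.
have [d2 d2E] : is_derive (0 : R) 1 (derive1 A) l := near_eq_is_derive A1E dA1.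
split => //; first by apply: filterS near_r => s /dA[].
by rewrite /derive1n /= derive1E d2E.
Qed.

Unset Implicit Arguments.

Theorem corollary5p9 (R : realType) (x0 y0 z0 : R) :
  stable_surface
    [set p : R * R * R | expR (p.2 + z0) * (p.1.2 - y0) + p.1.1 - x0 = 0].
Proof.
exists (chart x0 y0 z0); first exact: global_chart_chart.
exact: area_stable_chart.
Qed.
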